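(* Let $(M^{2n+1},\phi,\xi,\eta,g)$ be a Sasakian manifold and let $\{U_i,f_i,\gamma_{ij}\}$ be a cocycle defining the transversely Kählerian foliation $\mathcal F_\xi$ generated by $\xi$. For each $i$ let $\nabla^i$ be the linear connection on $U_i$ obtained by lifting the Levi Civita connection $\hat\nabla'$ of the Kählerian base under $f_i$, i.e. determined by: for basic vector fields $Z_1,Z_2$ on $U_i$, $\nabla^i_{Z_1}Z_2$ is the unique basic vector field on $U_i$ with $f_{i\ast}(\nabla^i_{Z_1}Z_2)=\hat\nabla'_{f_{i\ast}(Z_1)}f_{i\ast}(Z_2)$; $\nabla^i\xi=0$; and $\nabla^i_\xi V=[\xi,V]$ for every vector field $V$ on $U_i$. Then the family of connections $(\nabla^i)_{i\in I}$ gives rise to a global connection on $M^{2n+1}$ (that is, $\nabla^i=\nabla^j$ on $U_i\cap U_j$ whenever $U_i\cap U_j\neq\emptyset$), which coincides with the Tanaka-Webster connection of $(M^{2n+1},\phi,\xi,\eta,g)$.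
   Context: All manifolds are smooth and connected. Convention: $2d\eta(V,W)=V(\eta(W))-W(\eta(V))-\eta([V,W])$. A contact form on $M^{2n+1}$ is a 1-form $\eta$ with $\eta\wedge(d\eta)^n\neq0$ everywhere; its Reeb vector field $\xi$ is determined by $\eta(\xi)=1$, $d\eta(\xi,\cdot)=0$; $\mathcal D=\ker\eta$ is called the contact (horizontal) distribution. A contact metric structure $(\phi,\xi,\eta,g)$ consists of a contact form $\eta$ with Reeb field $\xi$, a Riemannian metric $g$ with $g(V,\xi)=\eta(V)$ and a $(1,1)$-tensor $\phi$ with $\phi^2=-I+\eta\otimes\xi$ and $d\eta(V,W)=g(V,\phi W)$. Set $h=\frac12\mathcal L_\xi\phi$; $\hat\nabla$ is the Levi Civita connection of $g$. The manifold is Sasakian if $[\phi,\phi]+2d\eta\otimes\xi=0$, equivalently $(\hat\nabla_V\phi)W=g(V,W)\xi-\eta(W)V$ for all $V,W$. The (generalized) Tanaka-Webster connection is $^{\ast}\nabla_VW=\hat\nabla_VW+\eta(V)\phi W+\eta(W)(\phi V+\phi hV)+d\eta(V+hV,W)\xi$. On a Sasakian manifold the foliation $\mathcal F_\xi$ by integral curves of $\xi$ is transversely Kählerian: it is defined by a cocycle consisting of an open covering $\{U_i\}_{i\in I}$ of $M^{2n+1}$, submersions $f_i:U_i\to M'^{2n}$ with $\ker f_{i\ast}=\mathbb R\xi$ into a Kählerian manifold $(M'^{2n},J,\omega,G)$, where $J,\omega,G$ are the projections of $\phi,d\eta,g$ (so $f_{i\ast}\circ\phi=J\circ f_{i\ast}$,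 $f_i^*\omega=d\eta$, and $f_i$ is a Riemannian submersion), and local diffeomorphisms $\gamma_{ij}:f_j(U_i\cap U_j)\to f_i(U_i\cap U_j)$ preserving the Kählerian structure with $\gamma_{ij}\circ f_j=f_i$ on $U_i\cap U_j$. A basic vector field on $U_i$ is a section of $\mathcal D$ over $U_i$ that is $f_i$-related to a vector field on the base. $\hat\nabla'$ is the Levi Civita connection of $(M'^{2n},G)$. *)

(* Defs.v *)
From mathcomp Require Import all_boot all_order all_algebra perm.
From mathcomp Require Import all_classical all_reals all_analysis.
Import Order.TTheory GRing.Theory Num.Theory.
Import numFieldNormedType.Exports.

Set Implicit Arguments.
Unset Strict Implicit.
Unset Printing Implicit Defensive.

Local Open Scope classical_set_scope.
Local Open Scope ring_scope.

Fixpoint Ck (R : realType) (m k : nat) (U : set 'rV[R]_m) (f : 'rV[R]_m -> R)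
    : Prop :=
  if k is k'.+1 then
    (forall x, U x -> differentiable f x) /\
    (forall i : 'I_m, Ck k' U ('D_(delta_mx 0 i) f))
  else forall x, U x -> {for x, continuous f}.

Definition Csmooth (R : realType) (m : nat) (U : set 'rV[R]_m)
    (f : 'rV[R]_m -> R) : Prop :=
  forall k, Ck k U f.

(* A chart is a homeomorphism from [cdom] onto an open subset of R^m; [cmap]
   and its inverse [cinv] are total functions, meaningful on [cdom] and on
   [cmap @` cdom] only. *)
Record chart (R : realType) (T : topologicalType) (m : nat) := Chart {
  cdom : set T;
  cmap : T -> 'rV[R]_m;
  cinv : 'rV[R]_m -> T;
  cdom_open : open cdom;
  cimg_open : open (cmap @` cdom);
  cmap_continuous : forall p, cdom p -> {for p, continuous cmap};
  cinv_continuous : forall x, (cmap @` cdom) x -> {for x, continuous cinv};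
  cmapK : forall p, cdom p -> cinv (cmap p) = p
}.

(* The atlas is not required to be maximal. *)
Record manifold (R : realType) (m : nat) := Manifold {
  points :> topologicalType;
  atlas : set (chart R points m);
  atlas_cover : forall p : points, exists2 c, atlas c & cdom c p;
  atlas_smooth : forall c d, atlas c -> atlas d -> forall j : 'I_m,
    Csmooth (cmap c @` (cdom c `&` cdom d)) (fun x => cmap d (cinv c x) 0 j);
  manifold_hausdorff : hausdorff_space points;
  manifold_second_countable : @second_countable points;
  manifold_connected : connected [set: points]
}.

(* In what follows the set [W] (or [U], [V]) is always open where used. *)
Definition smooth_on (R : realType) (m : nat) (M : manifold R m) (W : set M)
    (f : M -> R) : Prop :=
  forall c, atlas c -> Csmooth (cmap c @` (W `&` cdom c)) (f \o cinv c).

Definition smooth_at (R : realType) (m : nat) (M : manifold R m) (p : M)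
    (f : M -> R) : Prop :=
  exists W : set M, [/\ open W, W p & smooth_on W f].

Definition smooth_map (R : realType) (m m' : nat) (M : manifold R m)
    (N : manifold R m') (W : set M) (F : M -> N) : Prop :=
  (forall p, W p -> {for p, continuous F}) /\
  (forall c d, atlas c -> atlas d -> forall j : 'I_m',
    Csmooth (cmap c @` (W `&` F @^-1` cdom d `&` cdom c))
            (fun x => cmap d (F (cinv c x)) 0 j)).

(* Tangent vectors at [p] are directional derivatives acting on the functions
   that are smooth near [p].  So that two tangent vectors are equal as soon as
   they agree on these functions, all operators vanish on the other ones. *)
Notation vec R M := ((M -> R) -> R) (only parsing).

Definition on_smooth (R : realType) (m : nat) (M : manifold R m) (p : M)
    (v : vec R M) : vec R M :=
  fun f => if `[< smooth_at p f >] then v f else 0.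

Definition tangent (R : realType) (m : nat) (M : manifold R m) (p : M)
    (v : vec R M) : Prop :=
  exists (c : chart R M m) (a : 'rV[R]_m), [/\ atlas c, cdom c p &
    v = on_smooth p (fun f => 'D_a (f \o cinv c) (cmap c p))].

Definition push (R : realType) (m m' : nat) (M : manifold R m)
    (N : manifold R m') (F : M -> N) (p : M) (v : vec R M) : vec R N :=
  on_smooth (F p) (fun u => v (u \o F)).

(* Local vector fields and tensors are also total functions: only their values
   at points of the open set, resp. at tangent vectors, matter. *)
Notation vecfield R M := (M -> (M -> R) -> R) (only parsing).

Definition smooth_field (R : realType) (m : nat) (M : manifold R m) (W : set M)
    (X : vecfield R M) : Prop :=
  (forall p, W p -> tangent p (X p)) /\
  (forall (V : set M) (f : M -> R), open V -> V `<=` W -> smooth_on V f ->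
     smooth_on V (fun p => X p f)).

Definition fscale (R : realType) (m : nat) (M : manifold R m) (f : M -> R)
    (X : vecfield R M) : vecfield R M :=
  fun p => f p *: X p.

Definition bracket (R : realType) (m : nat) (M : manifold R m)
    (X Y : vecfield R M) : vecfield R M :=
  fun p => on_smooth p
    (fun f => X p (fun q => Y q f) - Y p (fun q => X q f)).

Definition oneform (R : realType) (m : nat) (M : manifold R m)
    (eta : M -> vec R M -> R) : Prop :=
  (forall p a v w, tangent p v -> tangent p w ->
     eta p (a *: v + w) = a * eta p v + eta p w) /\
  (forall (W : set M) X, open W -> smooth_field W X ->
     smooth_on W (fun p => eta p (X p))).

Definition endo (R : realType) (m : nat) (M : manifold R m)
    (A : M -> vec R M -> vec R M) : Prop :=
  [/\ forall p v, tangent p v -> tangent p (A p v),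
      forall p a v w, tangent p v -> tangent p w ->
        A p (a *: v + w) = a *: A p v + A p w &
      forall (W : set M) X, open W -> smooth_field W X ->
        smooth_field W (fun p => A p (X p))].

Definition metric (R : realType) (m : nat) (M : manifold R m)
    (g : M -> vec R M -> vec R M -> R) : Prop :=
  [/\ forall p a u v w, tangent p u -> tangent p v -> tangent p w ->
        g p (a *: u + v) w = a * g p u w + g p v w,
      forall p v w, tangent p v -> tangent p w -> g p v w = g p w v,
      forall p v, tangent p v -> v <> 0 -> 0 < g p v v &
      forall (W : set M) X Y, open W -> smooth_field W X -> smooth_field W Y ->
        smooth_on W (fun p => g p (X p) (Y p))].

(* 2 d eta(X,Y) = X(eta(Y)) - Y(eta(X)) - eta([X,Y]) *)
Definition dform (R : realType) (m : nat) (M : manifold R m)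
    (eta : M -> vec R M -> R) (X Y : vecfield R M) (p : M) : R :=
  2^-1 * (X p (fun q => eta q (Y q)) - Y p (fun q => eta q (X q))
          - eta p (bracket X Y p)).

(* (eta /\ (d eta)^n)(X_0, ..., X_2n) at [p]: the full antisymmetrization
   (normalized by 1/(2n+1)!, in accordance with the factor 2 in [dform]) of
   eta(X_0) d eta(X_1,X_2) ... d eta(X_(2n-1),X_2n). *)
Definition wedge_top (R : realType) (n : nat) (M : manifold R n.*2.+1)
    (eta : M -> vec R M -> R) (X : 'I_n.*2.+1 -> vecfield R M) (p : M) : R :=
  (n.*2.+1)`!%:R^-1 * \sum_(s : 'S_n.*2.+1) (-1) ^+ s *
    (eta p (X (s ord0) p) *
     \prod_(k < n) dform eta (X (s (inord k.*2.+1))) (X (s (inord k.*2.+2))) p).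

Definition nijenhuis (R : realType) (m : nat) (M : manifold R m)
    (A : M -> vec R M -> vec R M) (X Y : vecfield R M) (p : M) : vec R M :=
  A p (A p (bracket X Y p))
  + bracket (fun q => A q (X q)) (fun q => A q (Y q)) p
  - A p (bracket (fun q => A q (X q)) Y p)
  - A p (bracket X (fun q => A q (Y q)) p).

Definition contact_form (R : realType) (n : nat) (M : manifold R n.*2.+1)
    (eta : M -> vec R M -> R) : Prop :=
  oneform eta /\
  forall p : M, exists (W : set M) (X : 'I_n.*2.+1 -> vecfield R M),
    [/\ open W, W p, forall i, smooth_field W (X i) & wedge_top eta X p != 0].

Definition reeb (R : realType) (n : nat) (M : manifold R n.*2.+1)
    (eta : M -> vec R M -> R) (xi : vecfield R M) : Prop :=
  [/\ smooth_field setT xi,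
      forall p, eta p (xi p) = 1 &
      forall (W : set M) X, open W -> smooth_field W X ->
        forall p, W p -> dform eta xi X p = 0].

Record contact_metric (R : realType) (n : nat) (M : manifold R n.*2.+1)
    (phi : M -> vec R M -> vec R M) (xi : vecfield R M) (eta : M -> vec R M -> R)
    (g : M -> vec R M -> vec R M -> R) : Prop := ContactMetric {
  cm_contact : contact_form eta;
  cm_reeb : reeb eta xi;
  cm_metric : metric g;
  cm_g_xi : forall p v, tangent p v -> g p v (xi p) = eta p v;
  cm_endo : endo phi;
  cm_phi2 : forall p v, tangent p v ->
    phi p (phi p v) = - v + eta p v *: xi p;
  cm_deta : forall (W : set M) X Y, open W -> smooth_field W X -> smooth_field W Y ->
    forall p, W p -> dform eta X Y p = g p (X p) (phi p (Y p))
}.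

Definition sasakian (R : realType) (n : nat) (M : manifold R n.*2.+1)
    (phi : M -> vec R M -> vec R M) (xi : vecfield R M) (eta : M -> vec R M -> R)
    (g : M -> vec R M -> vec R M -> R) : Prop :=
  contact_metric phi xi eta g /\
  forall (W : set M) X Y, open W -> smooth_field W X -> smooth_field W Y ->
    forall p, W p -> nijenhuis phi X Y p + (2 * dform eta X Y p) *: xi p = 0.

(* h = (1/2) L_xi phi, where (L_xi phi) X = [xi, phi X] - phi [xi, X] *)
Definition hten (R : realType) (m : nat) (M : manifold R m)
    (phi : M -> vec R M -> vec R M) (xi X : vecfield R M) : vecfield R M :=
  fun p => 2^-1 *:
    (bracket xi (fun q => phi q (X q)) p - phi p (bracket xi X p)).

Record kahler (R : realType) (m : nat) (N : manifold R m)
    (J : N -> vec R N -> vec R N) (omega : N -> vec R N -> vec R N -> R)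
    (G : N -> vec R N -> vec R N -> R) : Prop := Kahler {
  kahler_endo : endo J;
  kahler_J2 : forall p v, tangent p v -> J p (J p v) = - v;
  kahler_metric : metric G;
  kahler_hermitian : forall p v w, tangent p v -> tangent p w ->
    G p (J p v) (J p w) = G p v w;
  kahler_integrable : forall (W : set N) X Y, open W ->
    smooth_field W X -> smooth_field W Y -> forall p, W p -> nijenhuis J X Y p = 0;
  kahler_omega : forall p v w, tangent p v -> tangent p w ->
    omega p v w = G p v (J p w);
  kahler_closed : forall (W : set N) X Y Z, open W ->
    smooth_field W X -> smooth_field W Y -> smooth_field W Z -> forall p, W p ->
    X p (fun q => omega q (Y q) (Z q)) + Y p (fun q => omega q (Z q) (X q))
    + Z p (fun q => omega q (X q) (Y q))
    - omega p (bracket X Y p) (Z p) - omega p (bracket Y Z p) (X p)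
    - omega p (bracket Z X p) (Y p) = 0
}.

(* The connection on [U] is recorded as a local operator
   [D X Y] = D_X Y on the vector fields over the open subsets of [U]. *)
Record connection (R : realType) (m : nat) (M : manifold R m) (U : set M)
    (D : vecfield R M -> vecfield R M -> vecfield R M) : Prop := Connection {
  conn_vfield : forall (W : set M) X Y, open W -> W `<=` U ->
    smooth_field W X -> smooth_field W Y -> smooth_field W (D X Y);
  conn_local : forall (W : set M) X X' Y Y', open W -> W `<=` U ->
    smooth_field W X -> smooth_field W X' -> smooth_field W Y -> smooth_field W Y' ->
    {in W, X =1 X'} -> {in W, Y =1 Y'} -> {in W, D X Y =1 D X' Y'};
  conn_linear : forall (W : set M) f X X' Y, open W -> W `<=` U ->
    smooth_on W f -> smooth_field W X -> smooth_field W X' -> smooth_field W Y ->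
    {in W, D (fscale f X + X') Y =1 fscale f (D X Y) + D X' Y};
  conn_add : forall (W : set M) X Y Y', open W -> W `<=` U ->
    smooth_field W X -> smooth_field W Y -> smooth_field W Y' ->
    {in W, D X (Y + Y') =1 D X Y + D X Y'};
  conn_leibniz : forall (W : set M) f X Y, open W -> W `<=` U ->
    smooth_on W f -> smooth_field W X -> smooth_field W Y ->
    {in W, D X (fscale f Y) =1 fscale (fun p => X p f) Y + fscale f (D X Y)}
}.

Definition eq_connection (R : realType) (m : nat) (M : manifold R m)
    (U : set M) (D E : vecfield R M -> vecfield R M -> vecfield R M) : Prop :=
  forall (W : set M) X Y, open W -> W `<=` U -> smooth_field W X -> smooth_field W Y ->
    {in W, D X Y =1 E X Y}.

Record levi_civita (R : realType) (m : nat) (M : manifold R m)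
    (g : M -> vec R M -> vec R M -> R)
    (D : vecfield R M -> vecfield R M -> vecfield R M) : Prop := LeviCivita {
  lc_connection : connection setT D;
  lc_torsion : forall (W : set M) X Y, open W -> smooth_field W X -> smooth_field W Y ->
    {in W, D X Y - D Y X =1 bracket X Y};
  lc_metric : forall (W : set M) X Y Z, open W ->
    smooth_field W X -> smooth_field W Y -> smooth_field W Z -> forall p, W p ->
    X p (fun q => g q (Y q) (Z q)) = g p (D X Y p) (Z p) + g p (Y p) (D X Z p)
}.

(* [D] stands for the Levi-Civita connection of the contact metric structure *)
Definition tanaka_webster (R : realType) (m : nat) (M : manifold R m)
    (phi : M -> vec R M -> vec R M) (xi : vecfield R M) (eta : M -> vec R M -> R)
    (D : vecfield R M -> vecfield R M -> vecfield R M) (X Y : vecfield R M) : vecfield R M :=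
  fun p => D X Y p + eta p (X p) *: phi p (Y p)
    + eta p (Y p) *: (phi p (X p) + phi p (hten phi xi X p))
    + dform eta (X + hten phi xi X) Y p *: xi p.

Record transverse_cocycle (R : realType) (n : nat) (M : manifold R n.*2.+1)
    (phi : M -> vec R M -> vec R M) (xi : vecfield R M) (eta : M -> vec R M -> R)
    (g : M -> vec R M -> vec R M -> R)
    (N : manifold R n.*2) (J : N -> vec R N -> vec R N)
    (omega G : N -> vec R N -> vec R N -> R)
    (I : Type) (U : I -> set M) (f : I -> M -> N) (gamma : I -> I -> N -> N)
    : Prop := TransverseCocycle {
  tc_open : forall i, open (U i);
  tc_cover : forall p, exists i, U i p;
  tc_smooth : forall i, smooth_map (U i) (f i);
  tc_submersion : forall i p, U i p -> forall w, tangent (f i p) w ->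
    exists2 v, tangent p v & push (f i) p v = w;
  tc_kernel : forall i p, U i p -> forall v, tangent p v ->
    (push (f i) p v = 0 <-> exists a : R, v = a *: xi p);
  tc_phi : forall i p, U i p -> forall v, tangent p v ->
    push (f i) p (phi p v) = J (f i p) (push (f i) p v);
  tc_omega : forall i (W : set M) X Y, open W -> W `<=` U i ->
    smooth_field W X -> smooth_field W Y -> forall p, W p ->
    omega (f i p) (push (f i) p (X p)) (push (f i) p (Y p)) = dform eta X Y p;
  tc_metric : forall i p, U i p -> forall v w, tangent p v -> tangent p w ->
    eta p v = 0 -> eta p w = 0 ->
    G (f i p) (push (f i) p v) (push (f i) p w) = g p v w;
  tc_gamma_smooth : forall i j,
    smooth_map (f j @` (U i `&` U j)) (gamma i j);
  tc_gamma_img : forall i j x, (f j @` (U i `&` U j)) x ->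
    (f i @` (U i `&` U j)) (gamma i j x);
  tc_gamma_local_diffeo : forall i j x, (f j @` (U i `&` U j)) x ->
    exists V : set N, [/\ open V, V x, V `<=` f j @` (U i `&` U j),
      open (gamma i j @` V) &
      exists delta : N -> N, smooth_map (gamma i j @` V) delta /\
        forall y, V y -> delta (gamma i j y) = y];
  tc_gamma_J : forall i j x, (f j @` (U i `&` U j)) x ->
    forall v, tangent x v ->
    push (gamma i j) x (J x v) = J (gamma i j x) (push (gamma i j) x v);
  tc_gamma_omega : forall i j x, (f j @` (U i `&` U j)) x ->
    forall v w, tangent x v -> tangent x w ->
    omega (gamma i j x) (push (gamma i j) x v) (push (gamma i j) x w)
    = omega x v w;
  tc_gamma_metric : forall i j x, (f j @` (U i `&` U j)) x ->
    forall v w, tangent x v -> tangent x w ->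
    G (gamma i j x) (push (gamma i j) x v) (push (gamma i j) x w) = G x v w;
  tc_gamma_f : forall i j p, U i p -> U j p -> gamma i j (f j p) = f i p
}.

(* [Z] is a basic vector field on [U], projecting to the vector field [Z'] *)
Definition basic_over (R : realType) (m m' : nat) (M : manifold R m)
    (N : manifold R m') (eta : M -> vec R M -> R) (U : set M) (f : M -> N)
    (Z : vecfield R M) (Z' : vecfield R N) : Prop :=
  [/\ smooth_field U Z, forall p, U p -> eta p (Z p) = 0, smooth_field setT Z' &
      forall p, U p -> push f p (Z p) = Z' (f p)].

Record lifted_connection (R : realType) (m m' : nat) (M : manifold R m)
    (N : manifold R m') (xi : vecfield R M) (eta : M -> vec R M -> R)
    (U : set M) (f : M -> N) (D' : vecfield R N -> vecfield R N -> vecfield R N)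
    (D : vecfield R M -> vecfield R M -> vecfield R M) : Prop := LiftedConnection {
  lift_connection : connection U D;
  lift_basic : forall Z1 Z1' Z2 Z2', basic_over eta U f Z1 Z1' ->
    basic_over eta U f Z2 Z2' -> basic_over eta U f (D Z1 Z2) (D' Z1' Z2');
  lift_xi : forall X, smooth_field U X -> {in U, forall p, D X xi p = 0};
  lift_along_xi : forall X, smooth_field U X -> {in U, D xi X =1 bracket xi X}
}.

(* Main.v *)
Require Import Defs.
From mathcomp Require Import all_boot all_order all_algebra.
From mathcomp Require Import all_classical all_reals all_analysis.
From mathcomp Require Import ring lra.
Import Order.TTheory GRing.Theory Num.Theory.
Import numFieldNormedType.Exports.
Local Open Scope classical_set_scope.
Local Open Scope ring_scope.

(** Over each [U i] the Tanaka-Webster connection satisfies the three conditions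
    that define the lift of the Levi-Civita connection of the base, and these
    conditions admit a single solution. So it is the lift over every [U i]; lifts
    agree on overlaps because both equal its restriction.

    That it is a lift. Normality forces [h = 0], i.e. the Reeb field [xi] preserves
    [phi] ([lie_reeb_phi]). It also preserves [d eta], and [d eta = g (., phi .)], so
    the Koszul formula gives [LC X xi = - phi X] ([lc_reeb]). The correction terms of
    the Tanaka-Webster connection are chosen to turn this into [D X xi = 0] and
    [D xi X = [xi, X]] ([tanaka_webster_reeb], [tanaka_webster_along_reeb]). For basic
    [Z1], [Z2], the term [d eta (Z1, Z2) xi] removes the vertical part of [LC Z1 Z2],
    and the horizontal part projects to the Levi-Civita derivative on the base,
    because the Koszul formulas upstairs and downstairs have equal terms
    ([push_levi_civita], [tanaka_webster_lifted]).

    That the lift is unique. A connection is determined by its values on a local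
    frame ([connection_frame_ext]), and the conditions prescribe the values on [xi]
    and on basic fields. The frame is made of fields defined on all of [U i], which
    project to global fields of the base. Coordinate fields of the base
    cut off by smooth bump functions supply these ([exists_bump_function], resting on
    the smoothness of [exp (-1/t)] at [0] and on Hausdorffness), and [horizontal_lift]
    lifts them: fields projecting to a coordinate frame at one point project to a
    frame nearby, and inverting a smooth matrix of functions corrects them.

    The rest is calculus on manifolds: stability properties of smooth functions in
    Euclidean space, and the chain rule ([push_tvec]), from which the coordinate
    expression of tangent vectors in an arbitrary chart follows. Brackets of vector
    fields are vector fields because a torsion-free connection is given. *)

Set Implicit Arguments.
Unset Strict Implicit.
Unset Printing Implicit Defensive.

(** * Smooth functions on open subsets of Euclidean space *)

Section EuclideanCalculus.
Context {R : realType}.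

Lemma open_near_eq {T : topologicalType} {S : Type} {U : set T} {f g : T -> S} {x : T} :
  open U -> (forall y, U y -> f y = g y) -> U x -> \near x, f x = g x.
Proof.
by move=> oU fg Ux; apply: filterS (open_nbhs_nbhs (conj oU Ux)) => y; exact: fg.
Qed.

(** The difference of [f] and [g] vanishes near [x], so it is a little-o there. *)
Lemma near_eq_differentiable {V W : normedModType R} {f g : V -> W} {x : V} :
  (\near x, f x = g x) -> differentiable f x -> differentiable g x.
Proof.
move=> fg df.
have -> : g = f + (g - f) by apply/funext => y /=; rewrite !fctE addrC subrK.
apply: differentiableD => //.
set e := g - f.
have ex0 : e x = 0 by rewrite /e !fctE (nbhs_singleton fg) subrr.
have H : e \o shift x = cst (e x) + (0 : V -> W) +o_ 0 id.
  apply/eqaddoP => _/posnumP[eps].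
  have : \forall y \near 0, f (y + x) = g (y + x).
    by move: fg; rewrite (near_shift 0 x) /= subr0.
  apply: filterS => y fgy.
  by rewrite !fctE /= ex0 /e !fctE fgy subrr addr0 subr0 normr0 mulr_ge0.
have c0 : continuous (0 : V -> W) by move=> y; exact: cvg_cst.
pose L : {linear V -> W} := \0.
have E : 'd e x = (0 : V -> W) :> (V -> W).
  by apply: (@diff_unique _ _ _ _ L).
by apply/diff_locallyP; rewrite E.
Qed.

Section ChainRule.
Context {V : normedModType R} {m : nat}.
Implicit Types (F : V -> 'rV[R]_m) (u : 'rV[R]_m -> R) (x : V).

Lemma differentiable_rV F x :
  (forall j, differentiable (fun y => F y 0 j) x) -> differentiable F x.
Proof.
move=> dF.
have -> : F = \sum_(j < m) (fun y => F y 0 j *: (delta_mx 0 j : 'rV[R]_m)).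
  by apply/funext => y; rewrite [LHS]row_sum_delta fct_sumE.
by apply: differentiable_sum => j; apply: differentiableZl.
Qed.

Lemma derive_comp_rV u F x v :
  differentiable u (F x) -> (forall j, differentiable (fun y => F y 0 j) x) ->
  'D_v (u \o F) x = \sum_(j < m) 'D_(delta_mx 0 j) u (F x) * 'D_v (fun y => F y 0 j) x.
Proof.
move=> du dFj; have dF := differentiable_rV dFj.
rewrite deriveE; last exact: differentiable_comp.
rewrite diff_comp //= -(deriveE _ dF) derive_mx; last exact: diff_derivable.
rewrite [X in 'd u _ X]row_sum_delta linear_sum /=; apply: eq_bigr => j _.
by rewrite linearZ /= mxE (deriveE _ du) mulrC.
Qed.

End ChainRule.

Lemma derive_coord_sum {m : nat} (u : 'rV[R]_m -> R) x v : differentiable u x ->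
  'D_v u x = \sum_(j < m) 'D_(delta_mx 0 j) u x * v 0 j.
Proof.
move=> du; rewrite (deriveE _ du) {1}[v]row_sum_delta linear_sum /=.
by apply: eq_bigr => j _; rewrite linearZ /= (deriveE _ du) mulrC.
Qed.

Lemma derive_coord {m : nat} (x v : 'rV[R]_m) j :
  'D_v (fun y : 'rV[R]_m => y 0 j) x = v 0 j.
Proof.
have := @derive_mx _ _ _ _ (@id 'rV[R]_m) x v (@derivable_id _ _ x v).
by rewrite derive_id => /(congr1 (fun M : 'rV_m => M 0 j)); rewrite mxE => ->.
Qed.

Section Ck.
Context {m : nat}.
Implicit Types (U V : set 'rV[R]_m) (f g : 'rV[R]_m -> R).

Lemma Ck_sub k U V f : V `<=` U -> Ck k U f -> Ck k V f.
Proof.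
move=> VU; elim: k f => [|k IH] f /=; first by move=> cf x /VU; exact: cf.
by case=> df Df; split=> [x /VU|i]; [exact: df | exact: IH].
Qed.

(** The conditions defining [Ck] are imposed point by point. *)
Lemma Ck_local k U f :
  (forall x, U x -> exists2 V, V x & Ck k V f) -> Ck k U f.
Proof.
elim: k f => [|k IH] f /= H; first by move=> x /H[V Vx]; exact.
split=> [x /H[V Vx []]|i]; first by move=> + _; exact.
by apply: IH => x /H[V Vx [_ Df]]; exists V.
Qed.

Lemma Ck_eq k U f g : open U -> (forall x, U x -> f x = g x) ->
  Ck k U f -> Ck k U g.
Proof.
move=> oU; elim: k f g => [|k IH] f g fg /=.
  move=> cf x Ux; rewrite /prop_for /continuous_at -(fg x Ux).
  exact: cvg_trans (near_eq_cvg (open_near_eq oU fg Ux)) (cf x Ux).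
move=> [df Df]; split=> [x Ux|i].
  exact: near_eq_differentiable (open_near_eq oU fg Ux) (df x Ux).
by apply: IH (Df i) => x Ux; exact: near_eq_derive (open_near_eq oU fg Ux).
Qed.

Lemma CkW k U f : Ck k.+1 U f -> Ck k U f.
Proof.
elim: k f => [|k IH] f /= [df Df].
  by move=> x /df; exact: differentiable_continuous.
by split=> // i; exact: IH _ (Df i).
Qed.

Lemma Ck_cst k U a : Ck k U (cst a).
Proof.
elim: k a => [|k IH] a /=; first by move=> x _; exact: cst_continuous.
split=> [x _|i]; first exact: differentiable_cst.
rewrite (_ : 'D_ _ _ = cst 0) //.
by apply/funext => x; rewrite derive_cst.
Qed.

Lemma CkD k U f g : open U -> Ck k U f -> Ck k U g -> Ck k U (fun x => f x + g x).
Proof.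
move=> oU; elim: k f g => [|k IH] f g.
  by move=> cf cg x Ux; exact: cvgD (cf x Ux) (cg x Ux).
case=> df Df [dg Dg]; split=> [x Ux|i].
  by apply: differentiableD; [exact: df | exact: dg].
apply: Ck_eq oU _ (IH _ _ (Df i) (Dg i)) => x Ux /=.
by rewrite [RHS]deriveD //; apply: diff_derivable; [exact: df | exact: dg].
Qed.

Lemma CkM k U f g : open U -> Ck k U f -> Ck k U g -> Ck k U (fun x => f x * g x).
Proof.
move=> oU; elim: k f g => [|k IH] f g.
  by move=> cf cg x Ux; exact: cvgM (cf x Ux) (cg x Ux).
move=> Cf Cg; have [df Df] := Cf; have [dg Dg] := Cg; split=> [x Ux|i].
  by apply: differentiableM; [exact: df | exact: dg].
apply: (Ck_eq oU) (CkD oU (IH _ _ (CkW Cf) (Dg i))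
  (IH _ _ (CkW Cg) (Df i))) => x Ux /=.
by rewrite [RHS]deriveM //; apply: diff_derivable; [exact: df | exact: dg].
Qed.

(** The partial derivatives of [1/f] are [- D f * (1/f)^2], so the class of
    differentiability of [1/f] increases with each step of the induction. *)
Lemma CkV k U f : open U -> (forall x, U x -> f x != 0) -> Ck k U f ->
  Ck k U (fun x => (f x)^-1).
Proof.
move=> oU f0; elim: k => [|k IH].
  by move=> cf x Ux; exact: cvgV (f0 x Ux) (cf x Ux).
move=> Cf; have [df Df] := Cf; split=> [x Ux|i].
  by apply: differentiableV; [exact: df | exact: f0].
have Cv := IH (CkW Cf).
apply: (Ck_eq oU) (CkM oU (CkM oU (Ck_cst k U (-1)) (Df i))
  (CkM oU Cv Cv)) => x Ux /=.
rewrite [RHS](deriveV (f0 x Ux)); last by apply: diff_derivable; exact: df.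
by rewrite /cst mulN1r mulNr /GRing.scale /= mulNr expr2 invfM mulrC.
Qed.

End Ck.

Section Csmooth.
Context {m : nat}.
Implicit Types (U V : set 'rV[R]_m) (f g : 'rV[R]_m -> R).

Lemma Csmooth_sub U V f : V `<=` U -> Csmooth U f -> Csmooth V f.
Proof. by move=> VU Cf k; exact: Ck_sub (Cf k). Qed.

Lemma Csmooth_local U f :
  (forall x, U x -> exists2 V, V x & Csmooth V f) -> Csmooth U f.
Proof. by move=> H k; apply: Ck_local => x /H[V Vx Cf]; exists V. Qed.

Lemma Csmooth_eq U f g : open U -> (forall x, U x -> f x = g x) ->
  Csmooth U f -> Csmooth U g.
Proof. by move=> oU fg Cf k; exact: Ck_eq (Cf k). Qed.

Lemma Csmooth_differentiable U f x : Csmooth U f -> U x -> differentiable f x.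
Proof. by move=> /(_ 1%N)[+ _]; exact. Qed.

Lemma Csmooth_partial U f i : Csmooth U f -> Csmooth U ('D_(delta_mx 0 i) f).
Proof. by move=> Cf k; have [_ Df] := Cf k.+1; exact: Df. Qed.

Lemma Csmooth_cst U a : Csmooth U (cst a).
Proof. by move=> k; exact: Ck_cst. Qed.

Lemma CsmoothD U f g : open U -> Csmooth U f -> Csmooth U g ->
  Csmooth U (fun x => f x + g x).
Proof. by move=> oU Cf Cg k; exact: CkD. Qed.

Lemma CsmoothM U f g : open U -> Csmooth U f -> Csmooth U g ->
  Csmooth U (fun x => f x * g x).
Proof. by move=> oU Cf Cg k; exact: CkM. Qed.

Lemma CsmoothV U f : open U -> (forall x, U x -> f x != 0) -> Csmooth U f ->
  Csmooth U (fun x => (f x)^-1).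
Proof. by move=> oU f0 Cf k; exact: CkV. Qed.

Lemma Csmooth_sum U (I : Type) (r : seq I) (F : I -> 'rV[R]_m -> R) : open U ->
  (forall i, Csmooth U (F i)) -> Csmooth U (fun x => \sum_(i <- r) F i x).
Proof.
move=> oU CF; elim: r => [|i r IH].
  by apply: Csmooth_eq oU _ (Csmooth_cst U 0) => x _; rewrite big_nil.
by apply: Csmooth_eq oU _ (CsmoothD oU (CF i) IH) => x _; rewrite big_cons.
Qed.

Lemma Csmooth_prod U (I : Type) (r : seq I) (F : I -> 'rV[R]_m -> R) : open U ->
  (forall i, Csmooth U (F i)) -> Csmooth U (fun x => \prod_(i <- r) F i x).
Proof.
move=> oU CF; elim: r => [|i r IH].
  by apply: Csmooth_eq oU _ (Csmooth_cst U 1) => x _; rewrite big_nil.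
by apply: Csmooth_eq oU _ (CsmoothM oU (CF i) IH) => x _; rewrite big_cons.
Qed.

Lemma Csmooth_derive U f v : open U -> Csmooth U f -> Csmooth U ('D_v f).
Proof.
move=> oU Cf; apply: Csmooth_eq oU _ (Csmooth_sum (index_enum _) oU
    (fun j => CsmoothM oU (Csmooth_partial j Cf) (Csmooth_cst U (v 0 j)))).
by move=> x Ux; rewrite (@derive_coord_sum _ f x) //; exact: Csmooth_differentiable Cf Ux.
Qed.

End Csmooth.

(** By the chain rule the partial derivatives of [u o F] are combinations of the
    [(D_j u) o F] with smooth coefficients: the induction on the class of
    differentiability is over all [u] at once. *)
Lemma Csmooth_comp {m m'} (U : set 'rV[R]_m) (V : set 'rV[R]_m')
    (u : 'rV[R]_m' -> R) (F : 'rV[R]_m -> 'rV[R]_m') :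
  open U -> (forall x, U x -> V (F x)) -> Csmooth V u ->
  (forall j, Csmooth U (fun x => F x 0 j)) -> Csmooth U (u \o F).
Proof.
move=> oU UV Cu CF k; have dFj x j : U x -> differentiable (fun y => F y 0 j) x.
  exact: Csmooth_differentiable (CF j).
have dF x (Ux : U x) := differentiable_rV (dFj x ^~ Ux).
elim: k u Cu => [|k IH] u Cu.
  move=> x Ux; apply: continuous_comp.
    exact: differentiable_continuous (dF x Ux).
  exact/differentiable_continuous/(Csmooth_differentiable Cu)/UV.
have du x (Ux : U x) := Csmooth_differentiable Cu (UV x Ux).
split=> [x Ux|i]; first by apply: differentiable_comp; [exact: dF | exact: du].
suff Cs : Ck k U (fun x => \sum_(j <- index_enum 'I_m')
   'D_(delta_mx 0 j) u (F x) * 'D_(delta_mx 0 i) (fun y => F y 0 j) x).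
  apply: Ck_eq oU _ Cs => x Ux /=.
  by rewrite derive_comp_rV; [|exact: du|move=> j; exact: dFj].
elim: (index_enum _) => [|j r IHr].
  by apply: Ck_eq oU _ (Ck_cst k U 0) => x _; rewrite big_nil.
have Cj := CkM oU (IH _ (Csmooth_partial j Cu)) (Csmooth_partial i (CF j) k).
by apply: Ck_eq oU _ (CkD oU Cj IHr) => x _; rewrite big_cons.
Qed.

End EuclideanCalculus.

(** * A smooth bump function *)

Section Bump.
Context {R : realType}.
Implicit Types (P : {poly R}) (t : R).

(** The functions [P(1/t) exp(-1/t)], extended by zero to [t <= 0]: allowing any
    polynomial [P] makes this family stable under differentiation, whence smoothness. *)
Definition flat P t : R := if 0 < t then P.[t^-1] * expR (- t^-1) else 0.

(** The exponential dominates every power of [1/t]; two powers to spare make the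
    derivative at [0] exist and vanish. *)
Lemma flat_quadratic_bound P : exists C, forall t, `|flat P t| <= C * t ^+ 2.
Proof.
exists (\sum_(k < size P) `|P`_k| * k.+2`!%:R) => t.
rewrite /flat; case: ifPn => [t0|_]; last first.
  by rewrite normr0 mulr_ge0 ?sqr_ge0 // sumr_ge0 // => k _; rewrite mulr_ge0.
set y := t^-1; have y0 : 0 < y by rewrite invr_gt0.
have tE : t = y^-1 by rewrite invrK.
rewrite {}tE; clearbody y => {t t0}.
rewrite normrM [`|expR _|]ger0_norm ?expR_ge0 // horner_coef.
apply: le_trans (ler_wpM2r (expR_ge0 _) (ler_norm_sum _ _ _)) _.
rewrite !mulr_suml; apply: ler_sum => k _.
rewrite normrM (ger0_norm (exprn_ge0 _ (ltW y0))) -!mulrA ler_wpM2l //.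
have := @expR_ge1Dxn _ y k.+1 (ltW y0) => ey.
have {}ey : y ^+ k.+2 <= k.+2`!%:R * expR y.
  rewrite mulrC -ler_pdivrMr ?ltr0n ?fact_gt0 //.
  by apply: le_trans ey; rewrite ler_wpDl.
rewrite expRN ler_pdivrMr ?expR_gt0 // exprVn mulrAC.
by rewrite ler_pdivlMr ?exprn_gt0 // -exprD addn2.
Qed.


Lemma flat_is_derive P t : is_derive t 1 (flat P) (flat ('X^2 * (P - P^`())) t).
Proof.
have [t0|t0|->] := ltgtP t 0.
- rewrite {2}/flat ltNge (ltW t0) /=.
  apply: near_eq_is_derive (is_derive_cst 0 t 1).
  by near=> s; rewrite /flat ltNge ltW //; near: s; exact: lt_nbhsl.
- rewrite {2}/flat t0.
  have ne : \near t, (fun s => P.[s^-1] * expR (- s^-1)) t = flat P t.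
    by near=> s; rewrite /flat ifT //; near: s; exact: lt_nbhsr.
  apply: near_eq_is_derive ne _.
  have dV : is_derive t 1 (fun s : R => s^-1) (- t ^- 2 *: 1).
    by apply: (@is_deriveV _ id); rewrite gt_eqF.
  have dP := is_derive1_comp (is_derive_poly P t^-1) dV.
  have dE := @is_derive1_comp R expR (fun s => - s^-1) t _ _ (is_derive_expR _) (is_deriveN dV).
  apply: is_derive_eq (is_deriveM dP dE) _.
  rewrite !hornerE /GRing.scale /= !mulr1 exprVn; ring.
- rewrite {2}/flat ltxx; have [C HC] := flat_quadratic_bound P.
  have lim0 : (fun h => h^-1 *: ((flat P \o shift 0) (h *: 1) - flat P 0)) @ 0^' --> (0:R).
    have C0 : 0 <= C by have := HC 1; rewrite expr1n mulr1; apply: le_trans.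
    apply/cvgrPdist_lt => e e0; near=> h.
    have h0 : h != 0 by near: h; exact: nbhs_dnbhs_neq.
    rewrite sub0r normrN /= addr0 [h *: 1]mulr1 {2}/flat ltxx subr0 normrM normfV.
    rewrite ltr_pdivrMl ?normr_gt0 //; apply: le_lt_trans (HC h) _.
    rewrite -[h ^+ 2]ger0_norm ?sqr_ge0 // normrX expr2 mulrCA ltr_pM2l ?normr_gt0 //.
    apply: (@le_lt_trans _ _ ((C + 1) * `|h|)); first by rewrite ler_wpM2r // lerDl.
    rewrite -ltr_pdivlMl ?ltr_wpDl // mulrC.
    by near: h; apply: dnbhs0_lt; rewrite divr_gt0 // ltr_wpDl.
  apply: DeriveDef; first by apply/cvg_ex; exists 0.
  exact/cvg_lim.
Unshelve. all: by end_near. Qed.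

Lemma flat1_eq0 t : (flat 1 t == 0) = (t <= 0).
Proof.
by rewrite /flat leNgt; case: ifPn => _; rewrite ?eqxx // hornerE mul1r expR_eq0.
Qed.

Lemma Csmooth_flat_affine {m} (U : set 'rV[R]_m) P (s c : R) (j : 'I_m) : open U ->
  Csmooth U (fun x => flat P (s * x 0 j + c)).
Proof.
move=> oU k; pose a (x : 'rV[R]_m) := s * x 0 j + c.
have da x : differentiable a x.
  by apply: differentiableD => //; apply: differentiableM => //; exact: differentiable_coord.
have dflat Q t : differentiable (flat Q) t.
  by apply/derivable1_diffP; have [] := flat_is_derive Q t.
have df Q x : differentiable (fun x => flat Q (a x)) x by exact: differentiable_comp.
rewrite -/(Ck k U (fun x => flat P (a x))).
elim: k P => [|k IH] P; first by move=> x _; exact: differentiable_continuous.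
split=> [x _ //|i].
apply: Ck_eq oU _ (CkM oU (IH ('X^2 * (P - P^`())))
    (Ck_cst k U (s * (delta_mx 0 i : 'rV[R]_m) 0 j))) => x _.
rewrite [RHS]deriveE // -[in RHS]/(flat P \o a) diff_comp //=.
rewrite diff1E // derive1E; have [_ ->] := flat_is_derive P (a x).
rewrite -deriveE // /cst mulrC; congr (_ * _).
have dc : differentiable (fun x : 'rV[R]_m => x 0 j) x by exact: differentiable_coord.
rewrite (@deriveD _ _ _ (fun x : 'rV[R]_m => s * x 0 j) (cst c)) ?derive_cst ?addr0; last first.
- exact: derivable_cst.
- by apply: diff_derivable; apply: differentiableM.
by rewrite (@deriveZ _ _ _ (fun x : 'rV[R]_m => x 0 j) s) ?derive_coord //; exact: diff_derivable.
Qed.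


(** The norm is the sup norm, so a product over the coordinates of one-variable
    functions positive exactly on an interval does. *)
Lemma exists_bump {m} (x0 : 'rV[R]_m) (r : R) : 0 < r ->
  exists b : 'rV[R]_m -> R, [/\ forall U, open U -> Csmooth U b, b x0 != 0 &
    forall x, b x != 0 -> `|x - x0| <= r].
Proof.
move=> r0.
exists (fun x => \prod_j (flat 1 (1 * x 0 j + (r - x0 0 j))
                         * flat 1 (-1 * x 0 j + (r + x0 0 j)))); split.
- by move=> U oU; apply: Csmooth_prod => // j; apply: CsmoothM => //;
    apply: Csmooth_flat_affine.
- apply/prodf_neq0 => j _.
  by rewrite mulf_neq0 // flat1_eq0 -ltNge; lra.
- move=> x /prodf_neq0 H.
  rewrite [leLHS]/Num.Def.normr/= mx_normrE (bigmax_le _ (ltW r0))//= => -[i j] _.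
  have := H j isT; rewrite mulf_eq0 negb_or !flat1_eq0 -!ltNge !mxE ord1 => /andP[].
  by rewrite ler_norml => h1 h2; apply/andP; split; lra.
Qed.

End Bump.

(** * Smooth functions and smooth maps on manifolds *)

Lemma open_preimage_on {T S : topologicalType} {W : set T} {F : T -> S} {V : set S} :
  open W -> (forall p, W p -> {for p, continuous F}) -> open V ->
  open (W `&` F @^-1` V).
Proof.
move=> oW cF oV; rewrite openE => p [Wp VFp]; apply: filterI.
  exact: open_nbhs_nbhs.
by apply: (cF p Wp); exact: open_nbhs_nbhs.
Qed.

Section ManifoldFunctions.
Context {R : realType} {m : nat} {M : manifold R m}.
Implicit Types (c d : chart R M m) (W V : set M) (p q : M) (f g : M -> R).

Definition chart_coord d j : M -> R := fun p => cmap d p 0 j.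

Lemma cinv_img c x : (cmap c @` cdom c) x ->
  cdom c (cinv c x) /\ cmap c (cinv c x) = x.
Proof. by case=> p cp <-; rewrite cmapK. Qed.

(** The image of [W] under the chart is its preimage under the inverse chart. *)
Lemma open_chart_img c W : open W -> W `<=` cdom c -> open (cmap c @` W).
Proof.
move=> oW Wc; rewrite openE => x [p Wp xE].
have cx : (cmap c @` cdom c) x by exists p => //; exact: Wc.
have n1 : nbhs x (cmap c @` cdom c) by apply: open_nbhs_nbhs; split=> //; exact: cimg_open.
have n2 : nbhs x (cinv c @^-1` W).
  apply: (cinv_continuous cx); apply: open_nbhs_nbhs; split=> //.
  by rewrite -xE cmapK //; exact: Wc.
by apply: filterS (filterI n1 n2) => y [] [q cq <-]; rewrite /preimage /= cmapK // => Wq; exists q.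
Qed.

Lemma open_chart_imgI c W : open W -> open (cmap c @` (W `&` cdom c)).
Proof.
move=> oW; apply: open_chart_img; last exact: subIsetr.
by apply: openI => //; exact: cdom_open.
Qed.

Lemma near_chart {S : Type} c p (f g : M -> S) : cdom c p ->
  (\forall q \near p, f q = g q) ->
  \forall x \near cmap c p, (f \o cinv c) x = (g \o cinv c) x.
Proof.
move=> cp fg; have cx : (cmap c @` cdom c) (cmap c p) by exists p.
by have := cinv_continuous cx; rewrite /prop_for /continuous_at cmapK // => /(_ _ fg).
Qed.

Lemma smooth_on_sub W V f : V `<=` W -> smooth_on W f -> smooth_on V f.
Proof.
by move=> VW sf c ac; apply: Csmooth_sub (sf c ac); apply: image_subset; exact: setSI.
Qed.

Lemma smooth_on_local W f :
  (forall p, W p -> exists2 V, V p & smooth_on V f) -> smooth_on W f.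
Proof.
move=> H c ac; apply: Csmooth_local => _ [p [Wp cp] <-].
have [V Vp sf] := H p Wp; exists (cmap c @` (V `&` cdom c)); last exact: sf.
by exists p.
Qed.

Lemma smooth_on_eq W f g : open W -> (forall p, W p -> f p = g p) ->
  smooth_on W f -> smooth_on W g.
Proof.
move=> oW fg sf c ac; apply: Csmooth_eq (open_chart_imgI oW) _ (sf c ac).
by move=> _ [p [Wp cp] <-]; rewrite /= cmapK // fg.
Qed.

(** Charts of the atlas are related by smooth changes of coordinates. *)
Lemma smooth_on_one_chart c W f : atlas c -> open W -> W `<=` cdom c ->
  Csmooth (cmap c @` W) (f \o cinv c) -> smooth_on W f.
Proof.
move=> ac oW Wc Cf d ad.
apply: (@Csmooth_eq _ _ _ ((f \o cinv c) \o (fun x => cmap c (cinv d x)))).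
- exact: open_chart_imgI.
- by move=> _ [p [Wp dp] <-]; rewrite /= !cmapK //; exact: Wc.
apply: Csmooth_comp Cf _; first exact: open_chart_imgI.
  by move=> _ [p [Wp dp] <-]; rewrite cmapK //; exists p.
move=> j; apply: Csmooth_sub (atlas_smooth ad ac j).
by apply: image_subset => p [Wp dp]; split=> //; exact: Wc.
Qed.

Lemma smooth_on_cst W a : smooth_on W (cst a).
Proof. by move=> c ac; exact: Csmooth_cst. Qed.

Lemma smooth_onD W f g : open W -> smooth_on W f -> smooth_on W g ->
  smooth_on W (fun p => f p + g p).
Proof.
by move=> oW sf sg c ac; apply: CsmoothD (open_chart_imgI oW) (sf c ac) (sg c ac).
Qed.

Lemma smooth_onM W f g : open W -> smooth_on W f -> smooth_on W g ->
  smooth_on W (fun p => f p * g p).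
Proof.
by move=> oW sf sg c ac; apply: CsmoothM (open_chart_imgI oW) (sf c ac) (sg c ac).
Qed.

Lemma smooth_onN W f : open W -> smooth_on W f -> smooth_on W (fun p => - f p).
Proof.
move=> oW sf; apply: smooth_on_eq oW _ (smooth_onM oW (smooth_on_cst W (-1)) sf).
by move=> p _; rewrite mulN1r.
Qed.

Lemma smooth_onB W f g : open W -> smooth_on W f -> smooth_on W g ->
  smooth_on W (fun p => f p - g p).
Proof. by move=> oW sf sg; apply: smooth_onD => //; exact: smooth_onN. Qed.

Lemma smooth_onV W f : open W -> (forall p, W p -> f p != 0) -> smooth_on W f ->
  smooth_on W (fun p => (f p)^-1).
Proof.
move=> oW f0 sf c ac; apply: CsmoothV (open_chart_imgI oW) _ (sf c ac).
by move=> _ [p [Wp cp] <-]; rewrite /= cmapK // f0.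
Qed.

Lemma smooth_on_sum W (I : Type) (r : seq I) (F : I -> M -> R) : open W ->
  (forall i, smooth_on W (F i)) -> smooth_on W (fun p => \sum_(i <- r) F i p).
Proof.
move=> oW sF c ac; exact: Csmooth_sum _ r _ (open_chart_imgI oW) (fun i => sF i c ac).
Qed.

Lemma smooth_on_prod W (I : Type) (r : seq I) (F : I -> M -> R) : open W ->
  (forall i, smooth_on W (F i)) -> smooth_on W (fun p => \prod_(i <- r) F i p).
Proof.
move=> oW sF c ac; exact: Csmooth_prod _ r _ (open_chart_imgI oW) (fun i => sF i c ac).
Qed.

Lemma smooth_on_det W k (A : M -> 'M[R]_k) : open W ->
  (forall i j, smooth_on W (fun p => A p i j)) -> smooth_on W (fun p => \det (A p)).
Proof.
move=> oW sA; apply: smooth_on_sum => // s.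
by apply: smooth_onM => //; [exact: smooth_on_cst | exact: smooth_on_prod].
Qed.

(** Cramer's rule. *)
Lemma smooth_on_invmx W k (A : M -> 'M[R]_k) : open W ->
  (forall p, W p -> \det (A p) != 0) ->
  (forall i j, smooth_on W (fun p => A p i j)) ->
  forall i j, smooth_on W (fun p => invmx (A p) i j).
Proof.
move=> oW dA sA i j.
apply: (@smooth_on_eq _ (fun p => (\det (A p))^-1 *
    ((-1) ^+ (j + i) * \det (row' j (col' i (A p)))))) => //.
  by move=> p Wp; rewrite /invmx unitmxE unitfE dA // !mxE.
apply: smooth_onM => //; first by apply: smooth_onV => //; exact: smooth_on_det.
apply: smooth_onM => //; first exact: smooth_on_cst.
apply: smooth_on_det => // k1 k2.
by apply: smooth_on_eq oW _ (sA (lift j k1) (lift i k2)) => p _; rewrite !mxE.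
Qed.

Lemma smooth_at_on W f p : open W -> smooth_on W f -> W p -> smooth_at p f.
Proof. by move=> oW sf Wp; exists W. Qed.

Lemma smooth_at_near f g p : (\forall q \near p, f q = g q) -> smooth_at p f -> smooth_at p g.
Proof.
move=> /nbhs_interior; rewrite nbhsE => -[V [oV Vp] VS] [W [oW Wp sf]].
exists (V `&` W); split=> //; first exact: openI.
apply: smooth_on_eq (openI oV oW) _ (smooth_on_sub (@subIsetr _ V W) sf).
by move=> q [/VS/interior_subset].
Qed.

Lemma smooth_at_differentiable c p f : atlas c -> cdom c p -> smooth_at p f ->
  differentiable (f \o cinv c) (cmap c p).
Proof.
move=> ac cp [W [oW Wp sf]].
by apply: Csmooth_differentiable (sf c ac) _; exists p.
Qed.

Lemma smooth_at_continuous p f : smooth_at p f -> {for p, continuous f}.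
Proof.
move=> sf; have [c ac cp] := atlas_cover p.
have n : \near p, ((f \o cinv c) \o cmap c) p = f p.
  by apply: (open_near_eq (cdom_open c)) cp => q cq /=; rewrite cmapK.
rewrite /prop_for /continuous_at -[X in _ --> X](nbhs_singleton n).
apply: cvg_trans (near_eq_cvg n) _.
apply: continuous_comp; first exact: cmap_continuous.
exact/differentiable_continuous/smooth_at_differentiable.
Qed.

Lemma smooth_on_coord d j : atlas d -> smooth_on (cdom d) (chart_coord d j).
Proof.
move=> ad c ac; apply: Csmooth_sub (atlas_smooth ac ad j).
by rewrite setIC.
Qed.

End ManifoldFunctions.

Section SmoothMaps.
Context {R : realType} {m m' : nat} {M : manifold R m} {N : manifold R m'}.
Context {W : set M} {F : M -> N}.
Hypotheses (oW : open W) (sF : smooth_map W F).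

Lemma smooth_map_open V : open V -> open (W `&` F @^-1` V).
Proof. by have [cF _] := sF; exact: open_preimage_on. Qed.

Lemma smooth_map_coord d j : atlas d -> smooth_on (W `&` F @^-1` cdom d) (chart_coord d j \o F).
Proof. by have [_ cF] := sF => ad c ac; exact: cF. Qed.

Lemma smooth_on_comp V u : open V -> smooth_on V u -> smooth_on (W `&` F @^-1` V) (u \o F).
Proof.
move=> oV su; apply: smooth_on_local => p [Wp VFp].
have [d ad dFp] := atlas_cover (F p).
exists (W `&` F @^-1` (V `&` cdom d)) => //.
have oQ : open (W `&` F @^-1` (V `&` cdom d)).
  by apply: smooth_map_open; apply: openI => //; exact: cdom_open.
move=> c ac; apply: (@Csmooth_eq _ _ _ ((u \o cinv d) \o (fun x => cmap d (F (cinv c x))))).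
- exact: open_chart_imgI.
- by move=> _ [q [[Wq [VFq dFq]] cq] <-]; rewrite /= !cmapK.
apply: Csmooth_comp (su d ad) _; first exact: open_chart_imgI.
  by move=> _ [q [[Wq [VFq dFq]] cq] <-]; rewrite cmapK //; exists (F q).
move=> j; apply: Csmooth_sub (smooth_map_coord j ad ac).
by apply: image_subset => q [[Wq [VFq dFq]] cq].
Qed.

Lemma smooth_at_comp p u : W p -> smooth_at (F p) u -> smooth_at p (u \o F).
Proof.
move=> Wp [V [oV VFp su]]; exists (W `&` F @^-1` V); split=> //.
  exact: smooth_map_open.
exact: smooth_on_comp.
Qed.

Lemma smooth_map_near p (u u' : N -> R) : W p -> (\forall y \near F p, u y = u' y) ->
  \forall q \near p, (u \o F) q = (u' \o F) q.
Proof. by have [cF _] := sF => Wp uu'; have := cF p Wp _ uu'. Qed.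

End SmoothMaps.

(** * Tangent vectors *)

Section TangentVectors.
Context {R : realType} {m : nat} {M : manifold R m}.
Implicit Types (c d : chart R M m) (W V : set M) (p q : M) (f g : M -> R) (v w : vec R M).

(** The combination of the coordinate vector fields of [d] at [q] with
    coefficients [a]. *)
Definition tvec d q (a : 'rV[R]_m) : vec R M :=
  on_smooth q (fun f => 'D_a (f \o cinv d) (cmap d q)).

Lemma on_smoothE p v f : smooth_at p f -> on_smooth p v f = v f.
Proof. by move=> sf; rewrite /on_smooth; case: asboolP. Qed.

Lemma on_smooth_ext p v w : (forall f, smooth_at p f -> v f = w f) ->
  on_smooth p v = on_smooth p w.
Proof. by move=> vw; apply/funext => f; rewrite /on_smooth; case: asboolP => // /vw. Qed.

Lemma tvec_tangent d q a : atlas d -> cdom d q -> tangent q (tvec d q a).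
Proof. by move=> ad dq; exists d, a. Qed.

Lemma tvecE d q a f : atlas d -> cdom d q -> smooth_at q f ->
  tvec d q a f = \sum_(j < m) 'D_(delta_mx 0 j) (f \o cinv d) (cmap d q) * a 0 j.
Proof.
move=> ad dq sf; rewrite /tvec on_smoothE // derive_coord_sum //.
exact: smooth_at_differentiable.
Qed.

Lemma tvecP d q b a a' : atlas d -> cdom d q ->
  tvec d q (b *: a + a') = b *: tvec d q a + tvec d q a'.
Proof.
move=> ad dq; apply/funext => f; rewrite !fctE /=.
have [sf|nsf] := pselect (smooth_at q f); last first.
  by rewrite /tvec /on_smooth asboolF // scaler0 addr0.
rewrite !tvecE // /GRing.scale /= mulr_sumr -big_split /=.
by apply: eq_bigr => j _; rewrite !mxE; ring.
Qed.

Lemma smooth_at_coord d q j : atlas d -> cdom d q -> smooth_at q (chart_coord d j).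
Proof. by move=> ad dq; exists (cdom d); split=> //; [exact: cdom_open|exact: smooth_on_coord]. Qed.

Lemma tvec_coord d q a j : atlas d -> cdom d q -> tvec d q a (chart_coord d j) = a 0 j.
Proof.
move=> ad dq; rewrite /tvec on_smoothE; last exact: smooth_at_coord.
rewrite -(derive_coord (cmap d q) a j); apply: near_eq_derive.
apply: (open_near_eq (@cimg_open _ _ _ d)); last by exists q.
by move=> x /cinv_img[_ xE]; rewrite /chart_coord /= xE.
Qed.

Lemma tangent_nonsmooth p v f : tangent p v -> ~ smooth_at p f -> v f = 0.
Proof. by case=> c [a [_ _ ->]] nsf; rewrite /on_smooth asboolF. Qed.

Lemma tangent_on_smooth p v : tangent p v -> on_smooth p v = v.
Proof.
move=> tv; apply/funext => f; rewrite /on_smooth; case: asboolP => // nsf.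
by rewrite (tangent_nonsmooth tv nsf).
Qed.

Lemma tangent_near p v f g : tangent p v -> (\forall q \near p, f q = g q) -> v f = v g.
Proof.
move=> tv fg; have gf : \forall q \near p, g q = f q.
  by apply: filterS fg => q ->.
have [sf|nsf] := pselect (smooth_at p f); last first.
  rewrite !(tangent_nonsmooth tv) // => sg; apply: nsf; exact: smooth_at_near gf sg.
have sg := smooth_at_near fg sf.
case: tv => c [a [ac cp ->]]; rewrite !on_smoothE //.
exact/near_eq_derive/near_chart.
Qed.

Lemma tangentB p v f g : tangent p v -> smooth_at p f -> smooth_at p g ->
  v (fun q => f q - g q) = v f - v g.
Proof.
move=> + sf sg; case=> c [a [ac cp ->]]; rewrite !on_smoothE //.
  by rewrite -deriveB //; apply/diff_derivable/smooth_at_differentiable.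
have [W [oW Wp sfW]] := sf; have [V [oV Vp sgV]] := sg.
exists (W `&` V); split=> //; first exact: openI.
apply: smooth_onB; first exact: openI.
  exact: smooth_on_sub sfW.
exact: smooth_on_sub sgV.
Qed.

Lemma tangentMl p v a f : tangent p v -> smooth_at p f ->
  v (fun q => a * f q) = a * v f.
Proof.
move=> + sf; case=> c [b [ac cp ->]]; rewrite !on_smoothE //.
  by rewrite -[RHS]deriveZ //; apply/diff_derivable/smooth_at_differentiable.
have [W [oW Wp sfW]] := sf; exists W; split=> //.
by apply: smooth_onM => //; exact: smooth_on_cst.
Qed.

Lemma tangent_cst p v a : tangent p v -> v (cst a) = 0.
Proof.
case=> c [b [ac cp ->]]; rewrite /on_smooth; case: asboolP => // _.
by rewrite -[X in 'D__ X _]/(cst a) derive_cst.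
Qed.

End TangentVectors.

Section Push.
Context {R : realType} {m m' : nat} {M : manifold R m} {N : manifold R m'}.
Context {W : set M} {F : M -> N}.
Hypotheses (oW : open W) (sF : smooth_map W F).

(** By the chain rule, a pushed forward vector is known from the derivatives of
    the coordinates of [F]. For [F] the identity this is the change of charts. *)
Lemma push_tvec p v d : W p -> tangent p v -> atlas d -> cdom d (F p) ->
  push F p v = tvec d (F p) (\row_j v (chart_coord d j \o F)).
Proof.
move=> Wp tv ad dFp; have [c [a [ac cp vE]]] := tv.
apply: on_smooth_ext => u su.
have su' : smooth_at p (u \o F) by exact: (smooth_at_comp oW sF Wp su).
rewrite derive_coord_sum; last exact: smooth_at_differentiable.
rewrite vE on_smoothE // -[in LHS]/((u \o F) \o cinv c).
have sj j : smooth_at p (chart_coord d j \o F).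
  exact: (smooth_at_comp oW sF Wp (smooth_at_coord j ad dFp)).
pose G x := cmap d (F (cinv c x)).
have Gp : G (cmap c p) = cmap d (F p) by rewrite /G cmapK.
have nE : \forall x \near cmap c p, ((u \o cinv d) \o G) x = ((u \o F) \o cinv c) x.
  have n : \forall q \near p, (fun q => u (cinv d (cmap d (F q)))) q = (u \o F) q.
    apply: (smooth_map_near sF (u := fun y => u (cinv d (cmap d y))) Wp).
    by apply: (open_near_eq (cdom_open d)) dFp => y dy; rewrite cmapK.
  exact: near_chart n.
rewrite -(near_eq_derive _ nE) derive_comp_rV.
- by rewrite Gp; apply: eq_bigr => j _; rewrite mxE on_smoothE.
- by rewrite Gp; exact: smooth_at_differentiable.
- by move=> j; exact: (@smooth_at_differentiable _ _ _ c p (chart_coord d j \o F)).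
Qed.

Lemma push_tangent p v : W p -> tangent p v -> tangent (F p) (push F p v).
Proof.
move=> Wp tv; have [d ad dFp] := atlas_cover (F p).
by rewrite (push_tvec (d := d)) //; exact: tvec_tangent.
Qed.

Lemma pushE p v u : smooth_at (F p) u -> push F p v u = v (u \o F).
Proof. exact: on_smoothE. Qed.

Lemma pushP p a v w : push F p (a *: v + w) = a *: push F p v + push F p w.
Proof.
apply/funext => u; rewrite !fctE /push /on_smooth; case: asboolP => // _.
by rewrite scaler0 addr0.
Qed.

End Push.

Section TangentSpace.
Context {R : realType} {m : nat} {M : manifold R m}.
Implicit Types (c d : chart R M m) (W V : set M) (p q : M) (f g : M -> R) (v w : vec R M).

Lemma smooth_map_id : smooth_map [set: M] (@id M).
Proof.
split=> [p _|c d ac ad j]; first exact: cvg_id.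
by rewrite setTI setIC; exact: atlas_smooth.
Qed.

Lemma push_id p v : tangent p v -> push id p v = v.
Proof. exact: tangent_on_smooth. Qed.

(** A tangent vector is given in some chart of the atlas; being known from its
    values on coordinate functions, it has a coordinate expression in every chart.
    In particular vectors given in different charts can be added. *)
Lemma tangentE c p v : atlas c -> cdom c p -> tangent p v ->
  v = tvec c p (\row_j v (chart_coord c j)).
Proof.
move=> ac cp tv; rewrite -{1}(push_id tv).
exact: (push_tvec openT smooth_map_id).
Qed.

Lemma tangentP p a v w : tangent p v -> tangent p w -> tangent p (a *: v + w).
Proof.
move=> tv tw; have [c ac cp] := atlas_cover p.
rewrite (@tangentE c p v) // (@tangentE c p w) // -tvecP //.
exact: tvec_tangent.
Qed.

Lemma tangent0 p : tangent p (0 : vec R M).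
Proof.
have [c ac cp] := atlas_cover p.
have -> : (0 : vec R M) = -1 *: tvec c p 0 + tvec c p 0 by rewrite scaleN1r addNr.
by apply: tangentP; exact: tvec_tangent.
Qed.

Lemma tangentZ p a v : tangent p v -> tangent p (a *: v).
Proof. by move=> tv; rewrite -[_ *: _]addr0; apply: tangentP => //; exact: tangent0. Qed.

Lemma tangentD p v w : tangent p v -> tangent p w -> tangent p (v + w).
Proof. by move=> tv tw; rewrite -[v]scale1r; exact: tangentP. Qed.

Lemma tangentN p v : tangent p v -> tangent p (- v).
Proof. by move=> tv; rewrite -scaleN1r; exact: tangentZ. Qed.

End TangentSpace.

(** * Vector fields *)

Section VectorFields.
Context {R : realType} {m : nat} {M : manifold R m}.
Implicit Types (c d : chart R M m) (W V : set M) (p q : M) (f g : M -> R).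
Implicit Types (v w : vec R M) (X Y : vecfield R M).

Lemma fieldDE X Y p : (X + Y) p = X p + Y p. Proof. by []. Qed.

Lemma fscaleE f X p : fscale f X p = f p *: X p. Proof. by []. Qed.

Lemma smooth_field_tangent W X p : smooth_field W X -> W p -> tangent p (X p).
Proof. by case=> + _; exact. Qed.

Lemma smooth_field_on W X f : open W -> smooth_field W X -> smooth_on W f ->
  smooth_on W (fun p => X p f).
Proof. by move=> oW [_ sX]; exact: sX. Qed.

Lemma smooth_field_sub W V X : V `<=` W -> smooth_field W X -> smooth_field V X.
Proof.
move=> VW [tX sX]; split=> [p /VW|V' f oV' /subset_trans/(_ VW)]; first exact: tX.
exact: sX.
Qed.

Lemma smooth_field_at W X f p : open W -> W p -> smooth_field W X -> smooth_at p f ->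
  smooth_at p (fun q => X q f).
Proof.
move=> oW Wp sX [V [oV Vp sf]]; exists (W `&` V); split=> //; first exact: openI.
apply: smooth_field_on; first exact: openI.
  exact: smooth_field_sub (@subIsetl _ _ _) sX.
exact: smooth_on_sub (@subIsetr _ _ _) sf.
Qed.

Lemma smooth_field_eq W X Y : (forall p, W p -> X p = Y p) ->
  smooth_field W X -> smooth_field W Y.
Proof.
move=> XY [tX sX]; split=> [p Wp|V f oV VW sf]; first by rewrite -XY //; exact: tX.
by apply: smooth_on_eq oV _ (sX V f oV VW sf) => p /VW/XY ->.
Qed.

Lemma smooth_field_local W X :
  (forall p, W p -> exists V, [/\ open V, V p & smooth_field V X]) -> smooth_field W X.
Proof.
move=> H; split=> [p /H[V [_ Vp]]|V f oV VW sf]; first by move/smooth_field_tangent; exact.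
apply: smooth_on_local => p Vp; have [V' [oV' V'p sX]] := H p (VW p Vp).
exists (V `&` V') => //; have oVV := openI oV oV'.
apply: smooth_field_on => //; first exact: smooth_field_sub (@subIsetr _ _ _) sX.
exact: smooth_on_sub (@subIsetl _ _ _) sf.
Qed.

Lemma smooth_fieldD W X Y : smooth_field W X -> smooth_field W Y -> smooth_field W (X + Y).
Proof.
move=> [tX sX] [tY sY]; split=> [p Wp|V f oV VW sf].
  by apply: tangentD; [exact: tX | exact: tY].
by apply: smooth_onD => //; [exact: sX | exact: sY].
Qed.

Lemma smooth_fieldZ W f X : open W -> smooth_on W f -> smooth_field W X ->
  smooth_field W (fscale f X).
Proof.
move=> oW sf [tX sX]; split=> [p Wp|V g oV VW sg]; first exact: tangentZ (tX p Wp).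
by apply: smooth_onM => //; [exact: smooth_on_sub sf | exact: sX].
Qed.

Lemma smooth_field0 W : smooth_field W (0 : vecfield R M).
Proof. by split=> [p _|V f _ _ _]; [exact: tangent0 | exact: smooth_on_cst]. Qed.

Lemma smooth_field_sum W (I : Type) (r : seq I) (F : I -> vecfield R M) :
  (forall i, smooth_field W (F i)) -> smooth_field W (fun p => \sum_(i <- r) F i p).
Proof.
move=> sF; elim: r => [|i r IH].
  by apply: smooth_field_eq (smooth_field0 W) => p _; rewrite big_nil.
by apply: smooth_field_eq (smooth_fieldD (sF i) IH) => p _; rewrite big_cons.
Qed.

Lemma smooth_field_tvec d a : atlas d -> smooth_field (cdom d) (fun q => tvec d q a).
Proof.
move=> ad; split=> [q dq|V f oV Vd sf]; first exact: tvec_tangent.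
have Cf : Csmooth (cmap d @` V) (f \o cinv d).
  apply: Csmooth_sub (sf d ad); apply: image_subset => p Vp.
  by split=> //; exact: Vd.
have oI : open (cmap d @` V) by exact: open_chart_img.
apply: (smooth_on_one_chart ad oV Vd).
apply: Csmooth_eq oI _ (Csmooth_derive a oI Cf) => _ [q Vq <-] /=.
have dq := Vd q Vq.
by rewrite cmapK // /tvec on_smoothE //; exact: smooth_at_on sf Vq.
Qed.

(** Constant coordinates in a chart do. This passes pointwise identities from
    vector fields to tangent vectors. *)
Lemma tangent_extend W p v : open W -> W p -> tangent p v ->
  exists V X, [/\ open V, V `<=` W, V p, smooth_field V X & X p = v].
Proof.
move=> oW Wp tv; have [c ac cp] := atlas_cover p.
exists (W `&` cdom c), (fun q => tvec c q (\row_j v (chart_coord c j))); split=> //.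
- by apply: openI => //; exact: cdom_open.
- exact: smooth_field_sub (@subIsetr _ _ _) (smooth_field_tvec _ ac).
- by rewrite -tangentE.
Qed.

Lemma tangent_sum p (I : Type) (r : seq I) (F : I -> vec R M) :
  (forall i, tangent p (F i)) -> tangent p (\sum_(i <- r) F i).
Proof.
move=> tF; elim: r => [|i r IH]; first by rewrite big_nil; exact: tangent0.
by rewrite big_cons; exact: tangentD.
Qed.

Section Bumps.
Variables (d : chart R M m) (q0 : M).
Hypotheses (ad : atlas d) (dq0 : cdom d q0).

(** The support of the Euclidean bump is compact, so its image is closed in [M],
    which is Hausdorff: this is what makes the extension by zero smooth. *)
Lemma exists_bump_function : exists (rho : M -> R) (K : set M),
  [/\ smooth_on setT rho, rho q0 != 0, closed K, K `<=` cdom d &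
      forall q, ~ K q -> rho q = 0].
Proof.
set x0 := cmap d q0.
have : nbhs x0 (cmap d @` cdom d).
  by apply: open_nbhs_nbhs; split; [exact: cimg_open | exists q0].
move=> /nbhs_ballP[e /= e0 xe].
have r0 : 0 < e / 2 by rewrite divr_gt0.
set B := [set x | `|x - x0| <= e / 2].
have Bd : B `<=` cmap d @` cdom d.
  move=> x Bx; apply: xe; rewrite -ball_normE /ball_ /= distrC.
  by apply: le_lt_trans Bx _; rewrite ltr_pdivrMr // ltr_pMr // ltr1n.
have cB : compact B.
  apply: bounded_closed_compact.
    exists (`|x0| + e / 2); split; first exact: num_real.
    move=> y ly x Bx; apply: le_trans (ltW ly).
    by rewrite -(subrK x0 x) addrC; apply: le_trans (ler_normD _ _) _; rewrite lerD2l.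
  rewrite (_ : B = (fun x => `|x - x0|) @^-1` [set t | t <= e / 2]) //.
  apply: preimage_closed; [move=> x _ | exact: closed_le].
  have cB : (fun y => y - x0) @ x --> x - x0 by exact: cvgB cvg_id (cvg_cst _).
  exact: (cvg_norm cB).
have cK : closed (cinv d @` B).
  apply: compact_closed; first exact: manifold_hausdorff.
  apply: continuous_compact => //; apply: continuous_in_subspaceT => x.
  by rewrite inE => /Bd dx; exact: cinv_continuous.
have [b [sb b0 bB]] := exists_bump x0 r0.
pose rho q := if `[< cdom d q >] then b (cmap d q) else 0.
have Kd : cinv d @` B `<=` cdom d by move=> _ [x /Bd dx <-]; have [] := cinv_img dx.
have rho0 q : ~ (cinv d @` B) q -> rho q = 0.
  rewrite /rho; case: asboolP => // dq nK.
  have [//|bq] := eqVneq (b (cmap d q)) 0; case: nK.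
  by exists (cmap d q); [exact: bB | rewrite cmapK].
exists rho, (cinv d @` B); split=> //; last by rewrite /rho asboolT.
apply: smooth_on_local => q _; have [dq|ndq] := pselect (cdom d q).
  exists (cdom d) => //; apply: (smooth_on_one_chart ad (cdom_open d)) => //.
  have oI : open (cmap d @` cdom d) by exact: cimg_open.
  apply: Csmooth_eq oI _ (sb _ oI) => _ [p dp <-].
  by rewrite /= cmapK // /rho asboolT.
exists (~` (cinv d @` B)); first by move=> /Kd.
have oK : open (~` (cinv d @` B)) by exact: closed_openC.
by apply: smooth_on_eq oK _ (smooth_on_cst _ 0) => p /rho0 ->.
Qed.

(** Away from the chart [tvec d] is meaningless, but there the scaled field is zero. *)
Lemma smooth_field_bump (rho : M -> R) (K : set M) a :
  smooth_on setT rho -> closed K -> K `<=` cdom d -> (forall q, ~ K q -> rho q = 0) ->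
  smooth_field setT (fscale rho (fun q => tvec d q a)).
Proof.
move=> srho cK Kd rho0; apply: smooth_field_local => q _.
have [dq|ndq] := pselect (cdom d q).
  exists (cdom d); split=> //; first exact: cdom_open.
  apply: smooth_fieldZ (smooth_field_tvec a ad); first exact: cdom_open.
  exact: smooth_on_sub srho.
exists (~` K); split; [exact: closed_openC | by move/Kd |].
by apply: smooth_field_eq (smooth_field0 _) => p /rho0 rp; rewrite /fscale rp scale0r.
Qed.

End Bumps.

End VectorFields.

(** * One-forms and horizontal lifts *)

Section OneForms.
Context {R : realType} {m : nat} {M : manifold R m}.
Variables (eta : M -> vec R M -> R).
Hypothesis (oeta : oneform eta).
Implicit Types (p q : M) (v w : vec R M).

Lemma oneformP p a v w : tangent p v -> tangent p w ->
  eta p (a *: v + w) = a * eta p v + eta p w.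
Proof. by have [+ _] := oeta; exact. Qed.

Lemma oneform0 p : eta p 0 = 0.
Proof.
have := @oneformP p (-1) 0 0 (tangent0 p) (tangent0 p).
by rewrite scaler0 addr0 mulN1r addNr.
Qed.

Lemma oneformZ p a v : tangent p v -> eta p (a *: v) = a * eta p v.
Proof. by move=> tv; rewrite -[_ *: _]addr0 oneformP ?oneform0 ?addr0 //; exact: tangent0. Qed.

Lemma oneformD p v w : tangent p v -> tangent p w -> eta p (v + w) = eta p v + eta p w.
Proof. by move=> tv tw; rewrite -[v]scale1r oneformP // mul1r scale1r. Qed.

Lemma oneformN p v : tangent p v -> eta p (- v) = - eta p v.
Proof. by move=> tv; rewrite -scaleN1r oneformZ // mulN1r. Qed.

Lemma oneformB p v w : tangent p v -> tangent p w -> eta p (v - w) = eta p v - eta p w.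
Proof. by move=> tv tw; rewrite oneformD ?oneformN //; exact: tangentN. Qed.

Lemma oneform_sum p (I : Type) (r : seq I) (V : I -> vec R M) :
  (forall i, tangent p (V i)) -> eta p (\sum_(i <- r) V i) = \sum_(i <- r) eta p (V i).
Proof.
move=> tV; elim: r => [|i r IH]; first by rewrite !big_nil oneform0.
by rewrite !big_cons oneformD ?IH //; exact: tangent_sum.
Qed.

End OneForms.

Section HorizontalLift.
Context {R : realType} {m m' : nat} {M : manifold R m} {N : manifold R m'}.
Variables (eta : M -> vec R M -> R) (xi : vecfield R M) (U : set M) (F : M -> N).
Hypotheses (oeta : oneform eta) (sxi : smooth_field setT xi).
Hypothesis (eta_xi : forall p, eta p (xi p) = 1).
Hypotheses (oU : open U) (sF : smooth_map U F).
Hypothesis submersion : forall p, U p -> forall w, tangent (F p) w ->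
  exists2 v, tangent p v & push F p v = w.
Hypothesis push_kernel : forall p, U p -> forall v, tangent p v ->
  (push F p v = 0 <-> exists a : R, v = a *: xi p).

Lemma push_vertical p : U p -> push F p (xi p) = 0.
Proof.
move=> Up; apply/(push_kernel Up (smooth_field_tangent sxi I)).
by exists 1; rewrite scale1r.
Qed.

(** The kernel of the projection is spanned by [xi], on which [eta] is injective. *)
Lemma horizontal_inj p v w : U p -> tangent p v -> tangent p w ->
  eta p v = eta p w -> push F p v = push F p w -> v = w.
Proof.
move=> Up tv tw evw pvw.
have txi : tangent p (xi p) by exact: smooth_field_tangent sxi I.
have tvw : tangent p (v - w) by apply: tangentD => //; exact: tangentN.
have [] := push_kernel Up tvw.
have -> : push F p (v - w) = 0.
  by rewrite addrC -scaleN1r pushP scaleN1r pvw addNr.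
move=> /(_ erefl)[a vwE] _.
have : eta p (v - w) = a by rewrite vwE (oneformZ oeta) // eta_xi mulr1.
rewrite (oneformB oeta) // evw subrr => a0.
by apply/eqP; rewrite -subr_eq0 vwE -a0 scale0r.
Qed.

Definition horizontal_part p v : vec R M := v - eta p v *: xi p.

Lemma horizontal_part_tangent p v : tangent p v -> tangent p (horizontal_part p v).
Proof.
move=> tv; apply: tangentD => //; apply/tangentN/tangentZ.
exact: smooth_field_tangent sxi I.
Qed.

Lemma eta_horizontal_part p v : tangent p v -> eta p (horizontal_part p v) = 0.
Proof.
have txi : tangent p (xi p) by exact: smooth_field_tangent sxi I.
move=> tv; rewrite (oneformB oeta) //; last exact: tangentZ.
by rewrite (oneformZ oeta) // eta_xi mulr1 subrr.
Qed.

Lemma push_horizontal_part p v : U p -> push F p (horizontal_part p v) = push F p v.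
Proof.
by move=> Up; rewrite /horizontal_part -scaleNr addrC pushP push_vertical // scaler0 add0r.
Qed.

(** Fields lifting a frame at one point form a frame of the normal bundle nearby:
    inverting the matrix of their pushforwards yields lifts of the coordinate
    fields, and this is where smoothness of horizontal lifts comes from. *)
Lemma horizontal_coordinate_frame p d : U p -> atlas d -> cdom d (F p) ->
  exists V (E : 'I_m' -> vecfield R M),
    [/\ open V, V `<=` U `&` F @^-1` cdom d, V p,
        forall k, smooth_field V (E k) &
        forall k q, V q -> eta q (E k q) = 0 /\
          push F q (E k q) = tvec d (F q) (delta_mx 0 k)].
Proof.
move=> Up ad dFp; have [c ac cp] := atlas_cover p.
have lift0 k : exists v, tangent p v /\ push F p v = tvec d (F p) (delta_mx 0 k).
  have [v tv vE] := submersion Up (tvec_tangent (delta_mx 0 k) ad dFp).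
  by exists v.
have [v vP] := choice lift0.
pose X k q := tvec c q (\row_j v k (chart_coord c j)).
have Xp k : X k p = v k by have [tv _] := vP k; rewrite /X -tangentE.
pose V0 := U `&` F @^-1` cdom d `&` cdom c.
have oV0 : open V0.
  by apply: openI (cdom_open c); apply: smooth_map_open => //; exact: cdom_open.
have sX k : smooth_field V0 (X k).
  exact: smooth_field_sub (@subIsetr _ _ _) (smooth_field_tvec _ ac).
pose A q : 'M[R]_m' := \matrix_(k, j) X k q (chart_coord d j \o F).
have sA k j : smooth_on V0 (fun q => A q k j).
  apply: (smooth_on_eq oV0 (f := fun q => X k q (chart_coord d j \o F))).
    by move=> q _; rewrite mxE.
  apply: smooth_field_on => //.
  exact: smooth_on_sub (@subIsetl _ _ _) (smooth_map_coord sF j ad).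
(* The fields were chosen so that the matrix is the identity at [p]; by
   continuity of the determinant it stays invertible nearby. *)
have Ap : A p = 1%:M.
  apply/matrixP => k j; rewrite !mxE Xp; have [tv vE] := vP k.
  have <- := pushE (v k) (smooth_at_coord j ad dFp).
  by rewrite vE tvec_coord // mxE eq_sym.
have sdet : smooth_on V0 (fun q => \det (A q)) by exact: smooth_on_det.
pose V := V0 `&` (fun q => \det (A q)) @^-1` [set t | t != 0].
have oV : open V.
  have cdet q : V0 q -> {for q, continuous (fun q => \det (A q))}.
    by move=> V0q; apply: smooth_at_continuous; exact: smooth_at_on sdet V0q.
  by apply: (open_preimage_on oV0 cdet); exact: open_neq.
have VV0 : V `<=` V0 by exact: subIsetl.
have sAV k j : smooth_on V (fun q => invmx (A q) k j).
  apply: smooth_on_invmx => // [q []//|k' j']; exact: smooth_on_sub (sA k' j').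
pose H k q := \sum_(j < m') (fscale (fun q => invmx (A q) k j) (X j)) q.
have sH k : smooth_field V (H k).
  apply: smooth_field_sum => j; apply: smooth_fieldZ => //.
  exact: smooth_field_sub (sX j).
have V0p : V0 p by [].
exists V, (fun k q => horizontal_part q (H k q)); split=> //.
- by apply: subset_trans VV0 _; exact: subIsetl.
- by split=> //=; rewrite Ap det1 oner_neq0.
- move=> k; apply: (@smooth_field_eq _ _ _ _
    (H k + fscale (fun q => - eta q (H k q)) xi)).
    by move=> q _; rewrite !fctE /horizontal_part /fscale scaleNr.
  apply: smooth_fieldD => //; apply: smooth_fieldZ => //.
    by apply: smooth_onN => //; have [_ seta] := oeta; exact: seta.
  exact: smooth_field_sub sxi.
move=> k q Vq; have tH := smooth_field_tangent (sH k) Vq.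
have [[[Uq dFq] cq] detq] := Vq.
split; first exact: eta_horizontal_part.
rewrite push_horizontal_part // (push_tvec oU sF Uq tH ad dFq); congr tvec.
apply/rowP => j; rewrite !mxE /= /H fct_sumE.
transitivity ((invmx (A q) *m A q) k j).
  by rewrite mxE; apply: eq_bigr => l _; rewrite mxE.
have uA : A q \in unitmx by rewrite unitmxE unitfE; exact: detq.
by rewrite (mulVmx uA) mxE eq_sym.
Qed.

(** The lift exists at each point; being unique there, it is near each point the
    combination of the lifted coordinate fields whose coefficients are the
    components of [Z'] along [F], and these are smooth. *)
Lemma horizontal_lift (V' : set N) (Z' : vecfield R N) : open V' -> smooth_field V' Z' ->
  exists Z : vecfield R M, smooth_field (U `&` F @^-1` V') Z /\
    forall q, (U `&` F @^-1` V') q -> eta q (Z q) = 0 /\ push F q (Z q) = Z' (F q).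
Proof.
move=> oV' sZ'.
have ex q : exists v, (U `&` F @^-1` V') q ->
    [/\ tangent q v, eta q v = 0 & push F q v = Z' (F q)].
  have [[Uq V'q]|nq] := pselect ((U `&` F @^-1` V') q); last by exists 0.
  have [v tv vE] := submersion Uq (smooth_field_tangent sZ' V'q).
  exists (horizontal_part q v) => _; split; [exact: horizontal_part_tangent | exact: eta_horizontal_part |].
  by rewrite push_horizontal_part.
have [Z ZP] := choice ex; exists Z; split; last by move=> q /ZP[].
apply: smooth_field_local => p [Up V'p].
have [d ad dFp] := atlas_cover (F p).
have [V [E [oV VU Vp sE EP]]] := horizontal_coordinate_frame Up ad dFp.
have oQ : open (V `&` (U `&` F @^-1` V')) by apply: openI => //; exact: smooth_map_open.
exists (V `&` (U `&` F @^-1` V')); split => //.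
pose a k q := Z' (F q) (chart_coord d k).
apply: (@smooth_field_eq _ _ _ _ (fun q => \sum_(k < m') (fscale (a k) (E k)) q)); last first.
  apply: smooth_field_sum => k; apply: smooth_fieldZ => //; last first.
    exact: smooth_field_sub (sE k).
  have oVd : open (V' `&` cdom d) by apply: openI => //; exact: cdom_open.
  have sa : smooth_on (V' `&` cdom d) (fun y => Z' y (chart_coord d k)).
    apply: smooth_field_on => //; first exact: smooth_field_sub sZ'.
    exact: smooth_on_sub (@subIsetr _ _ _) (smooth_on_coord k ad).
  apply: smooth_on_sub (smooth_on_comp oU sF oVd sa).
  by move=> q [/VU [_ dFq] [Uq V'q]].
move=> q [Vq [Uq V'q]]; have [_ dFq] := VU q Vq.
have [tZ eZ pZ] := ZP q (conj Uq V'q).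
have tE k : tangent q ((fscale (a k) (E k)) q).
  by apply: tangentZ; exact: smooth_field_tangent (sE k) Vq.
apply: (horizontal_inj Uq _ tZ); first exact: tangent_sum.
  rewrite (oneform_sum oeta) // eZ big1 // => k _.
  rewrite /fscale (oneformZ oeta); last exact: smooth_field_tangent (sE k) Vq.
  by have [-> _] := EP k q Vq; rewrite mulr0.
have Ecoord k j : E k q (chart_coord d j \o F) = (j == k)%:R.
  rewrite -(pushE (E k q) (smooth_at_coord j ad dFq)).
  by have [_ ->] := EP k q Vq; rewrite tvec_coord // mxE.
have aE k j : (fscale (a k) (E k)) q (chart_coord d j \o F) = a k q * (j == k)%:R.
  by rewrite -Ecoord.
rewrite pZ (push_tvec oU sF Uq (tangent_sum _ tE) ad dFq).
rewrite (tangentE ad dFq (smooth_field_tangent sZ' V'q)); congr tvec.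
apply/rowP => j; rewrite !mxE fct_sumE (bigD1 j) //= big1 ?addr0.
  by rewrite aE eqxx mulr1.
by move=> k kj; rewrite aE eq_sym (negbTE kj) mulr0.
Qed.

End HorizontalLift.

(** * Lie brackets, metrics and the Koszul formula *)

Section Brackets.
Context {R : realType} {m : nat} {M : manifold R m}.
Implicit Types (W V : set M) (p q : M) (f : M -> R).
Implicit Types (v w : vec R M) (X Y Z : vecfield R M).

Lemma bracketE X Y p f : smooth_at p f ->
  bracket X Y p f = X p (fun q => Y q f) - Y p (fun q => X q f).
Proof. exact: on_smoothE. Qed.

Lemma bracketC X Y p : bracket Y X p = - bracket X Y p.
Proof.
apply/funext => f; rewrite !fctE /bracket /on_smooth; case: asboolP => _.
  by rewrite opprB.
by rewrite oppr0.
Qed.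

Lemma bracket0l X p : tangent p (X p) -> bracket (0 : vecfield R M) X p = 0.
Proof.
move=> tX; apply/funext => f; rewrite /bracket /on_smooth; case: asboolP => // _.
by have := tangent_cst (0 : R) tX; rewrite -[X p (fun q => _)]/(X p (cst 0)) => ->; rewrite subr0.
Qed.

Lemma derive_bracket W X Y p v f : open W -> W p -> tangent p v ->
  smooth_field W X -> smooth_field W Y -> smooth_at p f ->
  v (fun q => bracket X Y q f) =
  v (fun q => X q (fun r => Y r f)) - v (fun q => Y q (fun r => X r f)).
Proof.
move=> oW Wp tv sX sY sf.
have sYf := smooth_field_at oW Wp sY sf; have sXf := smooth_field_at oW Wp sX sf.
have sXY := smooth_field_at oW Wp sX sYf; have sYX := smooth_field_at oW Wp sY sXf.
rewrite -(tangentB tv sXY sYX); apply: tangent_near tv _; have [V [oV Vp sfV]] := sf.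
by apply: (open_near_eq oV) Vp => q Vq; rewrite bracketE //; exact: smooth_at_on sfV Vq.
Qed.

(** Evaluated on a function this is the Jacobi identity for commutators of
    operators. *)
Lemma bracket_jacobi W X Y Z p : open W -> W p ->
  smooth_field W X -> smooth_field W Y -> smooth_field W Z ->
  bracket Z (bracket X Y) p = bracket (bracket Z X) Y p + bracket X (bracket Z Y) p.
Proof.
move=> oW Wp sX sY sZ; apply/funext => f; rewrite fctE.
have [sf|nsf] := pselect (smooth_at p f); last first.
  by rewrite /bracket /on_smooth !asboolF // addr0.
have tX := smooth_field_tangent sX Wp; have tY := smooth_field_tangent sY Wp.
have tZ := smooth_field_tangent sZ Wp.
have sXf := smooth_field_at oW Wp sX sf; have sYf := smooth_field_at oW Wp sY sf.
have sZf := smooth_field_at oW Wp sZ sf.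
rewrite !(bracketE _ _ sf) (derive_bracket oW Wp tZ sX sY sf).
rewrite (derive_bracket oW Wp tY sZ sX sf) (derive_bracket oW Wp tX sZ sY sf).
rewrite (bracketE _ _ sXf) (bracketE _ _ sYf) (bracketE _ _ sZf); ring.
Qed.

End Brackets.

Section Metrics.
Context {R : realType} {m : nat} {M : manifold R m}.
Context {g : M -> vec R M -> vec R M -> R}.
Hypothesis mg : metric g.
Implicit Types (p q : M) (u v w : vec R M).

Lemma metricC p v w : tangent p v -> tangent p w -> g p v w = g p w v.
Proof. by have [_ + _ _] := mg; exact. Qed.

Lemma metricPl p a u v w : tangent p u -> tangent p v -> tangent p w ->
  g p (a *: u + v) w = a * g p u w + g p v w.
Proof. by have [+ _ _ _] := mg; exact. Qed.

Lemma metric0l p w : tangent p w -> g p 0 w = 0.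
Proof.
move=> tw; have := @metricPl p (-1) 0 0 w (tangent0 p) (tangent0 p) tw.
by rewrite scaler0 addr0 mulN1r addNr.
Qed.

Lemma metricZl p a v w : tangent p v -> tangent p w -> g p (a *: v) w = a * g p v w.
Proof.
by move=> tv tw; rewrite -[_ *: _]addr0 metricPl ?metric0l ?addr0 //; exact: tangent0.
Qed.

Lemma metricDl p u v w : tangent p u -> tangent p v -> tangent p w ->
  g p (u + v) w = g p u w + g p v w.
Proof. by move=> tu tv tw; rewrite -[u]scale1r metricPl // mul1r scale1r. Qed.

Lemma metricNl p v w : tangent p v -> tangent p w -> g p (- v) w = - g p v w.
Proof. by move=> tv tw; rewrite -scaleN1r metricZl // mulN1r. Qed.

Lemma metricBl p u v w : tangent p u -> tangent p v -> tangent p w ->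
  g p (u - v) w = g p u w - g p v w.
Proof. by move=> tu tv tw; rewrite metricDl ?metricNl //; exact: tangentN. Qed.

Lemma metricDr p u v w : tangent p u -> tangent p v -> tangent p w ->
  g p w (u + v) = g p w u + g p w v.
Proof.
move=> tu tv tw; rewrite metricC ?metricDl //; last exact: tangentD.
by rewrite !(@metricC p _ w).
Qed.

Lemma metricZr p a v w : tangent p v -> tangent p w -> g p w (a *: v) = a * g p w v.
Proof.
by move=> tv tw; rewrite metricC ?metricZl ?(@metricC p v) //; exact: tangentZ.
Qed.

Lemma metricNr p v w : tangent p v -> tangent p w -> g p w (- v) = - g p w v.
Proof. by move=> tv tw; rewrite -scaleN1r metricZr // mulN1r. Qed.

Lemma metric_nondegenerate p v : tangent p v ->
  (forall w, tangent p w -> g p v w = 0) -> v = 0.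
Proof.
move=> tv gv; apply: contrapT => v0; have [_ _ + _] := mg.
by move=> /(_ p v tv v0); rewrite gv // ltxx.
Qed.

Lemma metric_inj p v w : tangent p v -> tangent p w ->
  (forall u, tangent p u -> g p v u = g p w u) -> v = w.
Proof.
move=> tv tw gvw; apply/eqP; rewrite -subr_eq0; apply/eqP.
apply: (@metric_nondegenerate p) => [|u tu]; first by apply: tangentD => //; exact: tangentN.
by rewrite metricBl // gvw // subrr.
Qed.

Section Koszul.
Context {D : vecfield R M -> vecfield R M -> vecfield R M}.
Hypothesis lcD : levi_civita g D.
Variable W : set M.
Hypothesis oW : open W.
Implicit Types (X Y Z : vecfield R M).

Lemma lc_smooth X Y : smooth_field W X -> smooth_field W Y -> smooth_field W (D X Y).
Proof. by move=> sX sY; apply: (conn_vfield (lc_connection lcD)). Qed.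

Lemma lc_bracket X Y p : smooth_field W X -> smooth_field W Y -> W p ->
  bracket X Y p = D X Y p - D Y X p.
Proof. by move=> sX sY Wp; rewrite -(lc_torsion lcD oW sX sY) // inE. Qed.

(** By torsion-freeness the bracket is a difference of covariant derivatives, which
    are vector fields. *)
Lemma bracket_smooth X Y : smooth_field W X -> smooth_field W Y ->
  smooth_field W (bracket X Y).
Proof.
move=> sX sY; apply: (@smooth_field_eq _ _ _ _ (D X Y + fscale (cst (-1)) (D Y X))).
  by move=> p Wp; rewrite (lc_bracket sX sY Wp) fctE /fscale scaleN1r.
apply: smooth_fieldD; first exact: lc_smooth.
by apply: smooth_fieldZ => //; [exact: smooth_on_cst | exact: lc_smooth].
Qed.

Lemma bracket_tangent X Y p : smooth_field W X -> smooth_field W Y -> W p ->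
  tangent p (bracket X Y p).
Proof. by move=> sX sY; apply: smooth_field_tangent; exact: bracket_smooth. Qed.

Lemma koszul X Y Z p : smooth_field W X -> smooth_field W Y -> smooth_field W Z -> W p ->
  2 * g p (D X Y p) (Z p) =
    X p (fun q => g q (Y q) (Z q)) + Y p (fun q => g q (Z q) (X q))
    - Z p (fun q => g q (X q) (Y q))
    + g p (bracket X Y p) (Z p) - g p (bracket Y Z p) (X p) + g p (bracket Z X p) (Y p).
Proof.
move=> sX sY sZ Wp.
have tX := smooth_field_tangent sX Wp; have tY := smooth_field_tangent sY Wp.
have tZ := smooth_field_tangent sZ Wp.
have tD A B : smooth_field W A -> smooth_field W B -> tangent p (D A B p).
  by move=> sA sB; exact: smooth_field_tangent (lc_smooth sA sB) Wp.
rewrite !(lc_metric lcD oW) // !lc_bracket // !metricBl //; try exact: tD.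
rewrite (metricC tY (tD _ _ sX sZ)) (metricC tZ (tD _ _ sY sX)) (metricC tX (tD _ _ sZ sY)).
ring.
Qed.

End Koszul.

End Metrics.

(** * The Tanaka-Webster connection of a Sasakian manifold *)

Section Sasakian.
Context {R : realType} {n : nat} {M : manifold R n.*2.+1}.
Context {phi : M -> vec R M -> vec R M} {xi : vecfield R M} {eta : M -> vec R M -> R}.
Context {g : M -> vec R M -> vec R M -> R}.
Context {LC : vecfield R M -> vecfield R M -> vecfield R M}.
Hypothesis sas : sasakian phi xi eta g.
Hypothesis lcg : levi_civita g LC.
Implicit Types (W V : set M) (p q : M) (v w : vec R M) (X Y Z : vecfield R M).

Let cm : contact_metric phi xi eta g := sas.1.
Let oeta : oneform eta := (cm_contact cm).1.
Let mg : metric g := cm_metric cm.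

Lemma reeb_smooth W : smooth_field W xi.
Proof. by have [sxi _ _] := cm_reeb cm; exact: smooth_field_sub sxi. Qed.

Lemma reeb_tangent p : tangent p (xi p).
Proof. exact: smooth_field_tangent (reeb_smooth setT) I. Qed.

Lemma eta_reeb p : eta p (xi p) = 1.
Proof. by have [_ + _] := cm_reeb cm; exact. Qed.

Lemma scale_reeb_eq0 p a : a *: xi p = 0 -> a = 0.
Proof.
by move/(congr1 (eta p)); rewrite (oneformZ oeta) ?(oneform0 oeta) ?eta_reeb ?mulr1 //;
  exact: reeb_tangent.
Qed.

Lemma phi_tangent p v : tangent p v -> tangent p (phi p v).
Proof. by have [+ _ _] := cm_endo cm; exact. Qed.

Lemma phi_smooth W X : open W -> smooth_field W X -> smooth_field W (fun q => phi q (X q)).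
Proof. by have [_ _ +] := cm_endo cm; exact. Qed.

Lemma phiP p a v w : tangent p v -> tangent p w ->
  phi p (a *: v + w) = a *: phi p v + phi p w.
Proof. by have [_ + _] := cm_endo cm; exact. Qed.

Lemma phi0 p : phi p 0 = 0.
Proof.
have := @phiP p (-1) 0 0 (tangent0 p) (tangent0 p).
by rewrite scaler0 addr0 scaleN1r addNr.
Qed.

Lemma phiZ p a v : tangent p v -> phi p (a *: v) = a *: phi p v.
Proof. by move=> tv; rewrite -[_ *: v]addr0 phiP ?phi0 ?addr0 //; exact: tangent0. Qed.

Lemma phiD p v w : tangent p v -> tangent p w -> phi p (v + w) = phi p v + phi p w.
Proof. by move=> tv tw; rewrite -[v]scale1r phiP // !scale1r. Qed.

Lemma phiN p v : tangent p v -> phi p (- v) = - phi p v.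
Proof. by move=> tv; rewrite -scaleN1r phiZ // scaleN1r. Qed.

(** The vector [u = phi xi] satisfies [phi u = 0] and so is a multiple [a *: xi];
    then [0 = phi u = a *: u = a ^+ 2 *: xi]. *)
Lemma phi_reeb p : phi p (xi p) = 0.
Proof.
have txi := reeb_tangent p; have tu := phi_tangent txi.
have phi_u : phi p (phi p (xi p)) = 0.
  by rewrite (cm_phi2 cm) // eta_reeb scale1r addNr.
have := cm_phi2 cm tu; rewrite phi_u phi0 => /esym/eqP.
rewrite addrC subr_eq0; set a := eta p _ => /eqP uE.
move: phi_u; rewrite -uE phiZ // -uE scalerA => /scale_reeb_eq0/eqP.
by rewrite mulf_eq0 orbb => /eqP ->; rewrite scale0r.
Qed.

Lemma phi3 p v : tangent p v -> phi p (phi p (phi p v)) = - phi p v.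
Proof.
move=> tv; rewrite (cm_phi2 cm tv) addrC phiP //; last exact: tangentN.
  by rewrite phi_reeb scaler0 add0r phiN.
exact: reeb_tangent.
Qed.

(** Compare the two ways of bracketing [phi ^ 3]. *)
Lemma eta_phi p v : tangent p v -> eta p (phi p v) = 0.
Proof.
move=> tv; apply: (@scale_reeb_eq0 p); have := cm_phi2 cm (phi_tangent tv).
by rewrite (phi3 tv) -[LHS]addr0 => /addrI.
Qed.

Lemma metric_reeb p v : tangent p v -> g p v (xi p) = eta p v.
Proof. exact: (cm_g_xi cm). Qed.

Lemma metric_reebl p v : tangent p v -> g p (xi p) v = eta p v.
Proof. by move=> tv; rewrite (metricC mg) ?metric_reeb //; exact: reeb_tangent. Qed.

Section OnOpen.
Variable W : set M.
Hypothesis oW : open W.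

Lemma eta_smooth X : smooth_field W X -> smooth_on W (fun q => eta q (X q)).
Proof. by have [_ +] := oeta; exact. Qed.

Lemma derive_eta_reeb X p : smooth_field W X -> W p -> X p (fun q => eta q (xi q)) = 0.
Proof.
move=> sX Wp; rewrite (_ : (fun q => eta q (xi q)) = cst 1).
  exact: tangent_cst (smooth_field_tangent sX Wp).
by apply/funext => q; rewrite eta_reeb.
Qed.

(** That is, [xi] preserves [eta], because it annihilates [d eta]. *)
Lemma eta_bracket_reeb X p : smooth_field W X -> W p ->
  eta p (bracket xi X p) = xi p (fun q => eta q (X q)).
Proof.
move=> sX Wp; have [_ _ dxi] := cm_reeb cm.
have /eqP := dxi W X oW sX p Wp.
rewrite /dform derive_eta_reeb // mulf_eq0 invr_eq0 pnatr_eq0 /= subr0 subr_eq0.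
by move/eqP.
Qed.

(** Normality evaluated at [xi] and [X] reads [phi (h X) = 0], and [h X] is
    horizontal, so [h X = 0]: the Reeb field preserves [phi]. *)
Lemma lie_reeb_phi X p : smooth_field W X -> W p ->
  bracket xi (fun q => phi q (X q)) p = phi p (bracket xi X p).
Proof.
move=> sX Wp; have [_ nor] := sas.
have sxi := reeb_smooth W; have spX := phi_smooth oW sX.
have tb := bracket_tangent lcg oW sxi sX Wp.
have tc := bracket_tangent lcg oW sxi spX Wp.
have [_ _ dxi] := cm_reeb cm.
have := nor W xi X oW sxi sX p Wp; rewrite (dxi W X oW sX p Wp) mulr0 scale0r addr0.
rewrite /nijenhuis (_ : (fun q => phi q (xi q)) = 0); last first.
  by apply/funext => q; rewrite phi_reeb.
rewrite (bracket0l (smooth_field_tangent spX Wp)) (bracket0l (smooth_field_tangent sX Wp)).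
rewrite phi0 subr0 addr0 => phik.
set c := bracket xi _ p in tc phik *; set b := bracket xi X p in tb phik *.
have tpb := phi_tangent tb.
have tk : tangent p (c - phi p b) by apply: tangentD => //; exact: tangentN.
have phik0 : phi p (c - phi p b) = 0.
  have tnpb := tangentN tpb.
  by rewrite (phiD tc tnpb) (phiN tpb) (subr0_eq phik) subrr.
have ek : eta p (c - phi p b) = 0.
  rewrite (oneformB oeta) // eta_phi // subr0 eta_bracket_reeb //.
  rewrite -[RHS](tangent_cst (0 : R) (reeb_tangent p)).
  apply: tangent_near (reeb_tangent p) _.
  by apply: (open_near_eq oW) Wp => q Wq; rewrite eta_phi //; exact: smooth_field_tangent sX Wq.
have := cm_phi2 cm tk; rewrite phik0 phi0 ek scale0r addr0 => /eqP.
by rewrite eq_sym oppr_eq0 subr_eq0 => /eqP.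
Qed.

Lemma hten_eq0 X p : smooth_field W X -> W p -> hten phi xi X p = 0.
Proof. by move=> sX Wp; rewrite /hten lie_reeb_phi // subrr scaler0. Qed.

Lemma dformC X Y p : smooth_field W X -> smooth_field W Y -> W p ->
  dform eta X Y p = - dform eta Y X p.
Proof.
move=> sX sY Wp; rewrite /dform (bracketC X Y) (oneformN oeta (bracket_tangent lcg oW sX sY Wp)).
ring.
Qed.

(** The Lie derivative along [xi] commutes with [d] by the Jacobi identity, and it
    kills [eta]. *)
Lemma lie_reeb_dform X Y p : smooth_field W X -> smooth_field W Y -> W p ->
  xi p (fun q => dform eta X Y q) =
  dform eta (bracket xi X) Y p + dform eta X (bracket xi Y) p.
Proof.
move=> sX sY Wp; have sxi := reeb_smooth W; have txi := reeb_tangent p.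
have tX := smooth_field_tangent sX Wp; have tY := smooth_field_tangent sY Wp.
have sb A B : smooth_field W A -> smooth_field W B -> smooth_field W (bracket A B).
  by move=> sA sB; exact: (bracket_smooth lcg oW sA sB).
have at_ f : smooth_on W f -> smooth_at p f by move=> sf; exact: smooth_at_on oW sf Wp.
have sxX := sb _ _ sxi sX; have sxY := sb _ _ sxi sY; have sXY := sb _ _ sX sY.
have fld A f : smooth_field W A -> smooth_on W f -> smooth_on W (fun q => A q f).
  exact: smooth_field_on.
have eX := eta_smooth sX; have eY := eta_smooth sY; have eXY := eta_smooth sXY.
rewrite /dform (tangentMl _ txi); last first.
  by apply: at_; apply: smooth_onB (smooth_onB _ (fld _ _ sX eY) (fld _ _ sY eX)) eXY.
rewrite (tangentB txi (at_ _ (smooth_onB oW (fld _ _ sX eY) (fld _ _ sY eX))) (at_ _ eXY)).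
rewrite (tangentB txi (at_ _ (fld _ _ sX eY)) (at_ _ (fld _ _ sY eX))).
rewrite -(eta_bracket_reeb sXY Wp) (bracket_jacobi oW Wp sX sY sxi).
rewrite (oneformD oeta); first last.
- exact: smooth_field_tangent (sb _ _ sX sxY) Wp.
- exact: smooth_field_tangent (sb _ _ sxX sY) Wp.
have nE A B : smooth_field W A -> smooth_field W B -> W p ->
    B p (fun q => eta q (bracket xi A q)) = B p (fun q => xi q (fun r => eta r (A r))).
  move=> sA sB _; apply: tangent_near (smooth_field_tangent sB Wp) _.
  by apply: (open_near_eq oW) Wp => q Wq; rewrite eta_bracket_reeb.
rewrite !nE // !(bracketE _ _ (at_ _ _)) //; ring.
Qed.

(** Since [xi] preserves both [phi] and [d eta = g (., phi .)], it preserves the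
    metric, at least against the image of [phi]. *)
Lemma lie_reeb_metric_phi X Y p : smooth_field W X -> smooth_field W Y -> W p ->
  xi p (fun q => g q (X q) (phi q (Y q))) =
  g p (bracket xi X p) (phi p (Y p)) + g p (X p) (bracket xi (fun q => phi q (Y q)) p).
Proof.
move=> sX sY Wp; have sxi := reeb_smooth W.
have sxX := bracket_smooth lcg oW sxi sX; have sxY := bracket_smooth lcg oW sxi sY.
transitivity (xi p (fun q => dform eta X Y q)).
  apply: tangent_near (reeb_tangent p) _.
  by apply: (open_near_eq oW) Wp => q Wq; rewrite (cm_deta cm oW).
by rewrite lie_reeb_dform // !(cm_deta cm oW) // lie_reeb_phi.
Qed.

Lemma metric_phi_skew_field X Y p : smooth_field W X -> smooth_field W Y -> W p ->
  g p (X p) (phi p (Y p)) = - g p (Y p) (phi p (X p)).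
Proof. by move=> sX sY Wp; rewrite -!(cm_deta cm oW) // dformC. Qed.

(** In Koszul's formula for [g (LC X xi) Z] the skew part in [X] and [Z] is [d eta]
    and the symmetric part is the Lie derivative of [g] along [xi], which vanishes
    for [Z = phi Y]. *)
Lemma lc_reeb_phi X Y p : smooth_field W X -> smooth_field W Y -> W p ->
  g p (LC X xi p) (phi p (Y p)) = g p (X p) (phi p (phi p (Y p))).
Proof.
move=> sX sY Wp; have sxi := reeb_smooth W; have sZ := phi_smooth oW sY.
set Z := (fun q => phi q (Y q)) in sZ.
have tX := smooth_field_tangent sX Wp; have tZ := smooth_field_tangent sZ Wp.
have K := koszul mg lcg oW sX sxi sZ Wp.
have lxg := lie_reeb_metric_phi sX sY Wp.
have dXZ := cm_deta cm oW sX sZ Wp.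
have tb A B (sA : smooth_field W A) (sB : smooth_field W B) := bracket_tangent lcg oW sA sB Wp.
have tang A q : smooth_field W A -> W q -> tangent q (A q) by exact: smooth_field_tangent.
have e1 : X p (fun q => g q (xi q) (Z q)) = X p (fun q => eta q (Z q)).
  apply: tangent_near tX _.
  by apply: (open_near_eq oW) Wp => q Wq; rewrite metric_reebl //; exact: tang.
have e2 : Z p (fun q => g q (X q) (xi q)) = Z p (fun q => eta q (X q)).
  apply: tangent_near tZ _.
  by apply: (open_near_eq oW) Wp => q Wq; rewrite metric_reeb //; exact: tang.
have e3 : xi p (fun q => g q (Z q) (X q)) = xi p (fun q => g q (X q) (Z q)).
  apply: tangent_near (reeb_tangent p) _.
  by apply: (open_near_eq oW) Wp => q Wq; rewrite (metricC mg) //; exact: tang.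
have e4 : g p (bracket X xi p) (Z p) = - g p (bracket xi X p) (Z p).
  by rewrite (bracketC xi X) (metricNl mg) //; exact: tb.
have e5 : g p (bracket xi Z p) (X p) = g p (X p) (bracket xi Z p).
  by rewrite (metricC mg) //; exact: tb.
have e6 : g p (bracket Z X p) (xi p) = - eta p (bracket X Z p).
  by rewrite metric_reeb ?(bracketC X Z) ?(oneformN oeta) //; [exact: tb | apply: tangentN; exact: tb].
move: K dXZ; rewrite e1 e2 e3 e4 e5 e6 /dform -[phi p (Y p)]/(Z p) lxg => K <-.
lra.
Qed.

(** Differentiate [g xi xi = 1]. *)
Lemma lc_reeb_horizontal X p : smooth_field W X -> W p -> g p (LC X xi p) (xi p) = 0.
Proof.
move=> sX Wp; have sxi := reeb_smooth W.
have tD := smooth_field_tangent (lc_smooth lcg oW sX sxi) Wp.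
have := lc_metric lcg oW sX sxi sxi Wp.
rewrite (metricC mg (reeb_tangent p) tD) (_ : (fun q => _) = cst 1); last first.
  by apply/funext => q; rewrite metric_reeb ?eta_reeb //; exact: reeb_tangent.
by rewrite (tangent_cst (1 : R) (smooth_field_tangent sX Wp)) => ?; lra.
Qed.

End OnOpen.

Lemma metric_phi_skew p v w : tangent p v -> tangent p w ->
  g p v (phi p w) = - g p w (phi p v).
Proof.
move=> tv tw; have [V [X [oV _ Vp sX <-]]] := tangent_extend openT I tv.
have [V' [Y [oV' V'V V'p sY <-]]] := tangent_extend oV Vp tw.
by apply: (metric_phi_skew_field oV') => //; exact: smooth_field_sub sX.
Qed.

(** It is enough to pair with [w = - phi (phi w) + eta w *: xi], the sum of a vector
    in the image of [phi] and a vertical one. *)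
Lemma lc_reeb W X p : open W -> smooth_field W X -> W p -> LC X xi p = - phi p (X p).
Proof.
move=> oW sX Wp; have sxi := reeb_smooth W.
have tX := smooth_field_tangent sX Wp.
have tD := smooth_field_tangent (lc_smooth lcg oW sX sxi) Wp.
apply: (metric_inj mg tD); first by apply/tangentN/phi_tangent.
move=> w tw; have tpw := phi_tangent tw; have tppw := phi_tangent tpw.
have txi := reeb_tangent p.
have wE : w = - phi p (phi p w) + eta p w *: xi p.
  by rewrite (cm_phi2 cm tw) opprD opprK subrK.
have [V [Y [oV VW Vp sY YE]]] := tangent_extend oW Wp tpw.
have := lc_reeb_phi oV (smooth_field_sub VW sX) sY Vp; rewrite YE phi3 // => H.
rewrite {1}wE (metricDr mg) //; [|exact: tangentN|exact: tangentZ].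
rewrite (metricNr mg) // (metricZr mg) // (lc_reeb_horizontal oW sX Wp) mulr0 addr0 H.
rewrite (metricNr mg) // opprK (metric_phi_skew tX tw) (metricNl mg) //; last exact: phi_tangent.
by rewrite (metricC mg) //; exact: phi_tangent.
Qed.

Section TanakaWebster.
Variable W : set M.
Hypothesis oW : open W.
Let TW := tanaka_webster phi xi eta LC.

(** With [h = 0] and [d eta = g (., phi .)], the correction to the Levi-Civita
    connection is a tensor, visible at the point [p] only. *)
Lemma tanaka_websterE X Y p : smooth_field W X -> smooth_field W Y -> W p ->
  TW X Y p = LC X Y p + eta p (X p) *: phi p (Y p) + eta p (Y p) *: phi p (X p)
             + g p (X p) (phi p (Y p)) *: xi p.
Proof.
move=> sX sY Wp; rewrite /TW /tanaka_webster.
have sh : smooth_field W (hten phi xi X).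
  by apply: smooth_field_eq (smooth_field0 W) => q Wq; rewrite (hten_eq0 oW).
rewrite (cm_deta cm oW (smooth_fieldD sX sh) sY Wp) fieldDE (hten_eq0 oW sX Wp).
by rewrite phi0 !addr0.
Qed.

Lemma tanaka_webster_smooth X Y : smooth_field W X -> smooth_field W Y ->
  smooth_field W (TW X Y).
Proof.
move=> sX sY; apply: (@smooth_field_eq _ _ _ _ (LC X Y
    + fscale (fun q => eta q (X q)) (fun q => phi q (Y q))
    + fscale (fun q => eta q (Y q)) (fun q => phi q (X q))
    + fscale (fun q => g q (X q) (phi q (Y q))) xi)).
  by move=> p Wp; rewrite (tanaka_websterE sX sY Wp).
have sZ f A : smooth_on W f -> smooth_field W A -> smooth_field W (fscale f A).
  exact: smooth_fieldZ.
have spX := phi_smooth oW sX; have spY := phi_smooth oW sY.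
have [_ _ _ sg] := mg.
apply: smooth_fieldD; last by apply: sZ (reeb_smooth W); exact: sg.
apply: smooth_fieldD; last by apply: sZ spX; exact: eta_smooth.
apply: smooth_fieldD; last by apply: sZ spY; exact: eta_smooth.
exact: (lc_smooth lcg oW sX sY).
Qed.

(** The term [phi X] of the connection cancels [LC X xi = - phi X]. *)
Lemma tanaka_webster_reeb X p : smooth_field W X -> W p -> TW X xi p = 0.
Proof.
move=> sX Wp; rewrite (tanaka_websterE sX (reeb_smooth W) Wp) (lc_reeb oW sX Wp).
have tX := smooth_field_tangent sX Wp.
by rewrite phi_reeb eta_reeb scale1r (metricC mg) ?(metric0l mg) ?scaler0 ?scale0r
  ?addr0 ?addNr //; exact: tangent0.
Qed.

(** As [LC] is torsion-free, [LC xi X = [xi, X] + LC X xi], and the term [phi X]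
    of the connection cancels the last summand. *)
Lemma tanaka_webster_along_reeb X p : smooth_field W X -> W p -> TW xi X p = bracket xi X p.
Proof.
move=> sX Wp; have sxi := reeb_smooth W; have tX := smooth_field_tangent sX Wp.
have tpX := phi_tangent tX.
rewrite (tanaka_websterE sxi sX Wp) (lc_bracket lcg oW sxi sX Wp) (lc_reeb oW sX Wp).
by rewrite phi_reeb scaler0 eta_reeb scale1r metric_reebl // eta_phi // scale0r !addr0 opprK.
Qed.

End TanakaWebster.

(** A tensorial correction does not affect the axioms of a connection. *)
Lemma tanaka_webster_connection : connection setT (tanaka_webster phi xi eta LC).
Proof.
have LCc := lc_connection lcg.
have tang W A q : smooth_field W A -> W q -> tangent q (A q) by exact: smooth_field_tangent.
split.
- by move=> W X Y oW _; exact: tanaka_webster_smooth.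
- move=> W X X' Y Y' oW WT sX sX' sY sY' XX' YY' p; rewrite inE => Wp.
  have pW : p \in W by rewrite inE.
  by rewrite !(tanaka_websterE oW) // (conn_local LCc oW WT sX sX' sY sY' XX' YY' pW) XX' ?YY'.
- move=> W f X X' Y oW WT sf sX sX' sY p; rewrite inE => Wp.
  have pW : p \in W by rewrite inE.
  have sfX := smooth_fieldZ oW sf sX.
  have tX := tang _ _ _ sX Wp; have tX' := tang _ _ _ sX' Wp; have tY := tang _ _ _ sY Wp.
  rewrite (tanaka_websterE oW (smooth_fieldD sfX sX') sY Wp).
  rewrite (conn_linear LCc oW WT sf sX sX' sY pW) [RHS]fieldDE !fscaleE.
  rewrite (tanaka_websterE oW sX sY Wp) (tanaka_websterE oW sX' sY Wp) ?fieldDE !fscaleE.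
  rewrite (oneformP oeta) // phiP // (metricPl mg) //; last exact: phi_tangent.
  apply/funext => u; rewrite !fctE /GRing.scale /=; ring.
- move=> W X Y Y' oW WT sX sY sY' p; rewrite inE => Wp.
  have pW : p \in W by rewrite inE.
  have tX := tang _ _ _ sX Wp; have tY := tang _ _ _ sY Wp; have tY' := tang _ _ _ sY' Wp.
  rewrite (tanaka_websterE oW sX (smooth_fieldD sY sY') Wp).
  rewrite (conn_add LCc oW WT sX sY sY' pW) [RHS]fieldDE.
  rewrite (tanaka_websterE oW sX sY Wp) (tanaka_websterE oW sX sY' Wp) !fieldDE.
  rewrite (oneformD oeta) // phiD // (metricDr mg) //; try exact: phi_tangent.
  apply/funext => u; rewrite !fctE /GRing.scale /=; ring.
- move=> W f X Y oW WT sf sX sY p; rewrite inE => Wp.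
  have pW : p \in W by rewrite inE.
  have tX := tang _ _ _ sX Wp; have tY := tang _ _ _ sY Wp.
  rewrite (tanaka_websterE oW sX (smooth_fieldZ oW sf sY) Wp).
  rewrite (conn_leibniz LCc oW WT sf sX sY pW) [RHS]fieldDE !fscaleE.
  rewrite (tanaka_websterE oW sX sY Wp) ?fieldDE !fscaleE.
  rewrite (oneformZ oeta) // phiZ // (metricZr mg) //; last exact: phi_tangent.
  apply/funext => u; rewrite !fctE /GRing.scale /=; ring.
Qed.

End Sasakian.

(** * Riemannian submersions *)

Definition related {R : realType} {m m' : nat} {M : manifold R m} {N : manifold R m'}
    (F : M -> N) (Q : set M) (Z : vecfield R M) (Z' : vecfield R N) : Prop :=
  forall q, Q q -> push F q (Z q) = Z' (F q).

Section RelatedFields.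
Context {R : realType} {m m' : nat} {M : manifold R m} {N : manifold R m'}.
Context {U : set M} {F : M -> N}.
Hypotheses (oU : open U) (sF : smooth_map U F).


Lemma related_derive Q Z Z' p (u : M -> R) (u' : N -> R) : related F Q Z Z' -> open Q -> Q p ->
  tangent p (Z p) -> smooth_at (F p) u' -> (forall q, Q q -> u q = u' (F q)) ->
  Z p u = Z' (F p) u'.
Proof.
move=> ZZ' oQ Qp tZ su' uu'; rewrite -ZZ' // pushE //.
by apply: tangent_near tZ _; exact: (open_near_eq oQ) Qp.
Qed.

Lemma related_bracket (Q : set M) (V : set N) Z1 Z1' Z2 Z2' p :
  open Q -> Q `<=` U `&` F @^-1` V -> open V -> Q p ->
  smooth_field Q Z1 -> smooth_field Q Z2 -> smooth_field V Z1' -> smooth_field V Z2' ->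
  related F Q Z1 Z1' -> related F Q Z2 Z2' ->
  push F p (bracket Z1 Z2 p) = bracket Z1' Z2' (F p).
Proof.
move=> oQ QU oV Qp sZ1 sZ2 sZ1' sZ2' r1 r2; apply: on_smooth_ext => u su.
have [Up VFp] := QU p Qp; have [V' [oV' V'Fp su']] := su.
have su1 := smooth_field_at oV VFp sZ1' su; have su2 := smooth_field_at oV VFp sZ2' su.
pose Q' := Q `&` (U `&` F @^-1` V').
have oQ' : open Q' by apply: openI => //; exact: (smooth_map_open oU sF).
have Q'p : Q' p by [].
have rel A B : related F Q A B -> related F Q' A B by move=> r q [Qq _]; exact: r.
rewrite (bracketE _ _ (smooth_at_comp oU sF Up su)).
congr (_ - _).
- apply: (related_derive (rel _ _ r1) oQ' Q'p _ su2).
    exact: smooth_field_tangent sZ1 Qp.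
  by move=> q [Qq [Uq V'Fq]]; rewrite -r2 // pushE //; exact: smooth_at_on su' V'Fq.
- apply: (related_derive (rel _ _ r2) oQ' Q'p _ su1).
    exact: smooth_field_tangent sZ2 Qp.
  by move=> q [Qq [Uq V'Fq]]; rewrite -r1 // pushE //; exact: smooth_at_on su' V'Fq.
Qed.

End RelatedFields.

Section RiemannianSubmersion.
Context {R : realType} {m m' : nat} {M : manifold R m} {N : manifold R m'}.
Context {eta : M -> vec R M -> R} {xi : vecfield R M} {U : set M} {F : M -> N}.
Hypotheses (oeta : oneform eta) (sxi : smooth_field setT xi).
Hypothesis (eta_xi : forall p, eta p (xi p) = 1).
Hypotheses (oU : open U) (sF : smooth_map U F).
Hypothesis submersion : forall p, U p -> forall w, tangent (F p) w ->
  exists2 v, tangent p v & push F p v = w.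
Hypothesis push_kernel : forall p, U p -> forall v, tangent p v ->
  (push F p v = 0 <-> exists a : R, v = a *: xi p).
Context {g : M -> vec R M -> vec R M -> R} {G : N -> vec R N -> vec R N -> R}.
Context {LC : vecfield R M -> vecfield R M -> vecfield R M}.
Context {LC' : vecfield R N -> vecfield R N -> vecfield R N}.
Hypotheses (mg : metric g) (mG : metric G).
Hypotheses (lcg : levi_civita g LC) (lcG : levi_civita G LC').
Hypothesis g_xi : forall p v, tangent p v -> g p v (xi p) = eta p v.
Hypothesis isometric : forall p, U p -> forall v w, tangent p v -> tangent p w ->
  eta p v = 0 -> eta p w = 0 -> G (F p) (push F p v) (push F p w) = g p v w.

(** The vertical part of [v] is orthogonal to the horizontal vector [w]. *)
Lemma metric_push p v w : U p -> tangent p v -> tangent p w -> eta p w = 0 ->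
  g p v w = G (F p) (push F p v) (push F p w).
Proof.
move=> Up tv tw ew; have txi : tangent p (xi p) by exact: smooth_field_tangent sxi I.
have th := horizontal_part_tangent eta sxi tv.
rewrite -(push_horizontal_part eta sxi push_kernel v Up) isometric //; last exact: eta_horizontal_part.
rewrite /horizontal_part (metricBl mg) //; last exact: tangentZ.
by rewrite (metricZl mg) // (metricC mg txi tw) g_xi // ew mulr0 subr0.
Qed.

(** O'Neill's formula: both sides are determined by their products with horizontal
    lifts of fields on the base, and the Koszul formulas for these products agree
    term by term. *)
Lemma push_levi_civita (V : set N) (Q : set M) Z1 Z1' Z2 Z2' p :
  open Q -> Q `<=` U `&` F @^-1` V -> open V -> Q p ->
  smooth_field Q Z1 -> smooth_field Q Z2 -> smooth_field V Z1' -> smooth_field V Z2' ->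
  (forall q, Q q -> eta q (Z1 q) = 0) -> (forall q, Q q -> eta q (Z2 q) = 0) ->
  related F Q Z1 Z1' -> related F Q Z2 Z2' ->
  push F p (LC Z1 Z2 p) = LC' Z1' Z2' (F p).
Proof.
move=> oQ QU oV Qp sZ1 sZ2 sZ1' sZ2' e1 e2 r1 r2.
have [Up VFp] := QU p Qp.
have tLC := smooth_field_tangent (lc_smooth lcg oQ sZ1 sZ2) Qp.
have tLC' := smooth_field_tangent (lc_smooth lcG oV sZ1' sZ2') VFp.
apply: (metric_inj mG (push_tangent oU sF Up tLC) tLC') => w tw.
have [V3 [Z3' [oV3 V3V V3Fp sZ3' Z3'E]]] := tangent_extend oV VFp tw.
have [Z3 [sZ3 Z3P]] := horizontal_lift oeta sxi eta_xi oU sF submersion push_kernel oV3 sZ3'.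
pose Q3 := Q `&` (U `&` F @^-1` V3).
have oQ3 : open Q3 by apply: openI => //; exact: (smooth_map_open oU sF).
have Q3p : Q3 p by [].
have Q3U : Q3 `<=` U `&` F @^-1` V3 by move=> q [].
have onQ3 A : smooth_field Q A -> smooth_field Q3 A by apply: smooth_field_sub => q [].
have {}sZ1 := onQ3 _ sZ1; have {}sZ2 := onQ3 _ sZ2.
have {}sZ3 : smooth_field Q3 Z3 by apply: smooth_field_sub sZ3 => q [].
have {}sZ1' := smooth_field_sub V3V sZ1'; have {}sZ2' := smooth_field_sub V3V sZ2'.
have {}r1 : related F Q3 Z1 Z1' by move=> q [Qq _]; exact: r1.
have {}r2 : related F Q3 Z2 Z2' by move=> q [Qq _]; exact: r2.
have r3 : related F Q3 Z3 Z3' by move=> q /Q3U/Z3P[].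
have {}e1 q : Q3 q -> eta q (Z1 q) = 0 by case=> Qq _; exact: e1.
have {}e2 q : Q3 q -> eta q (Z2 q) = 0 by case=> Qq _; exact: e2.
have e3 q : Q3 q -> eta q (Z3 q) = 0 by move=> /Q3U/Z3P[].
have dg A A' B B' C C' : related F Q3 A A' -> related F Q3 B B' -> related F Q3 C C' ->
    smooth_field Q3 A -> smooth_field Q3 B -> smooth_field Q3 C ->
    smooth_field V3 B' -> smooth_field V3 C' -> (forall q, Q3 q -> eta q (C q) = 0) ->
    A p (fun q => g q (B q) (C q)) = A' (F p) (fun y => G y (B' y) (C' y)).
  move=> rA rB rC sA sB sC sB' sC' eC.
  apply: (related_derive rA oQ3 Q3p); first exact: smooth_field_tangent sA Q3p.
    have [_ _ _ sG] := mG.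
    exact: smooth_at_on oV3 (sG _ _ _ oV3 sB' sC') V3Fp.
  move=> q Q3q; have [Uq V3q] := Q3U q Q3q.
  rewrite metric_push ?eC ?rB ?rC //; first exact: smooth_field_tangent sB Q3q.
  exact: smooth_field_tangent sC Q3q.
have gb A A' B B' C C' : related F Q3 A A' -> related F Q3 B B' -> related F Q3 C C' ->
    smooth_field Q3 A -> smooth_field Q3 B -> smooth_field Q3 C ->
    smooth_field V3 A' -> smooth_field V3 B' -> (forall q, Q3 q -> eta q (C q) = 0) ->
    g p (bracket A B p) (C p) = G (F p) (bracket A' B' (F p)) (C' (F p)).
  move=> rA rB rC sA sB sC sA' sB' eC.
  rewrite metric_push ?eC // ?rC //.
  - by rewrite (related_bracket oU sF oQ3 Q3U oV3 Q3p sA sB sA' sB' rA rB).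
  - exact: (bracket_tangent lcg oQ3).
  - exact: smooth_field_tangent sC Q3p.
have tZ3 := smooth_field_tangent sZ3 Q3p.
have K := koszul mg lcg oQ3 sZ1 sZ2 sZ3 Q3p.
have K' := koszul mG lcG oV3 sZ1' sZ2' sZ3' V3Fp.
rewrite (dg _ _ _ _ _ _ r1 r2 r3) // (dg _ _ _ _ _ _ r2 r3 r1) // (dg _ _ _ _ _ _ r3 r1 r2) // in K.
rewrite (gb _ _ _ _ _ _ r1 r2 r3) // (gb _ _ _ _ _ _ r2 r3 r1) // (gb _ _ _ _ _ _ r3 r1 r2) // in K.
rewrite -K' (metric_push Up tLC tZ3 (e3 p Q3p)) r3 // Z3'E in K.
lra.
Qed.

End RiemannianSubmersion.

(** * Connections and local frames *)

Section ConnectionsOnFrames.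
Context {R : realType} {m : nat} {M : manifold R m} {U : set M}.
Implicit Types (X Y : vecfield R M) (V W : set M).

Lemma connection_sub (U' : set M) D : U `<=` U' -> connection U' D -> connection U D.
Proof.
move=> UU' cD; split.
- by move=> W X Y oW WU; apply: (conn_vfield cD oW); exact: subset_trans UU'.
- by move=> W X X' Y Y' oW WU; apply: (conn_local cD oW); exact: subset_trans UU'.
- by move=> W f X X' Y oW WU; apply: (conn_linear cD oW); exact: subset_trans UU'.
- by move=> W X Y Y' oW WU; apply: (conn_add cD oW); exact: subset_trans UU'.
- by move=> W f X Y oW WU; apply: (conn_leibniz cD oW); exact: subset_trans UU'.
Qed.

Definition combination (I : Type) (r : seq I) (a : I -> M -> R) (E : I -> vecfield R M) :
  vecfield R M := fun p => \sum_(i <- r) a i p *: E i p.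

Lemma combination_cons (I : Type) i (r : seq I) a E :
  combination (i :: r) a E = fscale (a i) (E i) + combination r a E.
Proof. by apply/funext => p; rewrite fieldDE /combination big_cons. Qed.

Lemma combination_nil (I : Type) a (E : I -> vecfield R M) : combination [::] a E = 0.
Proof. by apply/funext => p; rewrite /combination big_nil. Qed.

Lemma combination_smooth (I : Type) (r : seq I) a E V : open V ->
  (forall i, smooth_on V (a i)) -> (forall i, smooth_field V (E i)) ->
  smooth_field V (combination r a E).
Proof.
move=> oV sa sE; apply: smooth_field_sum => i.
by apply: (@smooth_field_eq _ _ _ _ (fscale (a i) (E i))) => //; exact: smooth_fieldZ.
Qed.

Section OneConnection.
Variable D : vecfield R M -> vecfield R M -> vecfield R M.
Hypothesis cD : connection U D.
Variable V : set M.
Hypotheses (oV : open V) (VU : V `<=` U).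
Variables (I : Type) (E : I -> vecfield R M).
Hypothesis sE : forall i, smooth_field V (E i).

Lemma conn_combinationl r a Y p : (forall i, smooth_on V (a i)) -> smooth_field V Y -> V p ->
  D (combination r a E) Y p = \sum_(i <- r) a i p *: D (E i) Y p.
Proof.
move=> sa sY Vp; have pV : p \in V by rewrite inE.
elim: r => [|i r IH].
  rewrite combination_nil big_nil.
  have s0 := smooth_field0 V.
  have := conn_linear cD oV VU (smooth_on_cst V (-1)) s0 s0 sY pV.
  rewrite (_ : fscale (cst (-1)) 0 + 0 = 0 :> vecfield R M); last first.
    by apply/funext => q; rewrite fieldDE fscaleE scaler0 addr0.
  by rewrite fieldDE fscaleE scaleN1r addNr.
rewrite combination_cons big_cons.
have sc := combination_smooth r oV sa sE.
by rewrite (conn_linear cD oV VU (sa i) (sE i) sc sY pV) fieldDE fscaleE IH.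
Qed.

Lemma conn_combinationr r b X p : (forall i, smooth_on V (b i)) -> smooth_field V X -> V p ->
  D X (combination r b E) p = \sum_(i <- r) (X p (b i) *: E i p + b i p *: D X (E i) p).
Proof.
move=> sb sX Vp; have pV : p \in V by rewrite inE.
elim: r => [|i r IH].
  rewrite combination_nil big_nil; have s0 := smooth_field0 V.
  have := conn_add cD oV VU sX s0 s0 pV.
  by rewrite addr0 fieldDE -[LHS]addr0 => /addrI.
rewrite combination_cons big_cons.
have sc := combination_smooth r oV sb sE.
rewrite (conn_add cD oV VU sX (smooth_fieldZ oV (sb i) (sE i)) sc pV) fieldDE IH.
by rewrite (conn_leibniz cD oV VU (sb i) sX (sE i) pV) fieldDE !fscaleE.
Qed.

End OneConnection.

(** Function-linearity in [X] and the Leibniz rule in [Y] reduce both sides to the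
    frame: the derivatives of the coefficients of [Y] enter in the same way. *)
Lemma connection_frame_ext D D' W V (I : Type) (r : seq I) E a b X Y p :
  connection U D -> connection U D' -> open W -> W `<=` U ->
  smooth_field W X -> smooth_field W Y -> open V -> V `<=` W -> V p ->
  (forall i, smooth_field V (E i)) ->
  (forall i, smooth_on V (a i)) -> (forall i, smooth_on V (b i)) ->
  (forall q, V q -> X q = combination r a E q) ->
  (forall q, V q -> Y q = combination r b E q) ->
  (forall i j, D (E i) (E j) p = D' (E i) (E j) p) ->
  D X Y p = D' X Y p.
Proof.
move=> cD cD' oW WU sX sY oV VW Vp sE sa sb XE YE DE.
have VU := subset_trans VW WU; have pV : p \in V by rewrite inE.
have sX' := smooth_field_sub VW sX; have sY' := smooth_field_sub VW sY.
have scX := combination_smooth r oV sa sE; have scY := combination_smooth r oV sb sE.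
have XE' : {in V, X =1 combination r a E} by move=> q; rewrite inE; exact: XE.
have YE' : {in V, Y =1 combination r b E} by move=> q; rewrite inE; exact: YE.
rewrite (conn_local cD oV VU sX' scX sY' scY XE' YE' pV).
rewrite (conn_local cD' oV VU sX' scX sY' scY XE' YE' pV).
rewrite !(conn_combinationl _ oV VU) //; apply: eq_bigr => i _.
rewrite !(conn_combinationr _ oV VU) //; congr (_ *: _).
by apply: eq_bigr => j _; rewrite DE.
Qed.

End ConnectionsOnFrames.

(** * Lifted connections *)

Section BasicFrames.
Context {R : realType} {m m' : nat} {M : manifold R m} {N : manifold R m'}.
Context {eta : M -> vec R M -> R} {xi : vecfield R M} {U : set M} {F : M -> N}.
Hypotheses (oeta : oneform eta) (sxi : smooth_field setT xi).
Hypothesis (eta_xi : forall p, eta p (xi p) = 1).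
Hypotheses (oU : open U) (sF : smooth_map U F).
Hypothesis submersion : forall p, U p -> forall w, tangent (F p) w ->
  exists2 v, tangent p v & push F p v = w.
Hypothesis push_kernel : forall p, U p -> forall v, tangent p v ->
  (push F p v = 0 <-> exists a : R, v = a *: xi p).

Lemma basic_lift Z' : smooth_field setT Z' -> exists Z, basic_over eta U F Z Z'.
Proof.
move=> sZ'.
have [Z [sZ ZP]] := horizontal_lift oeta sxi eta_xi oU sF submersion push_kernel openT sZ'.
have UE : U `&` F @^-1` setT = U by rewrite preimage_setT setIT.
rewrite UE in sZ ZP; exists Z; split=> // p /ZP[//].
Qed.

(** Basic fields are required to be defined over all of [U] and to project to
    global fields of the base. Cutting off coordinate fields by a bump function
    provides enough of them; dividing by the bump function where it does not
    vanish recovers the coefficients of [X]. *)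
Lemma basic_frame p : U p ->
  exists (V : set M) (E : option 'I_m' -> vecfield R M) (E' : 'I_m' -> vecfield R N),
    [/\ open V /\ V `<=` U, V p, E None = xi,
        forall k, basic_over eta U F (E (Some k)) (E' k) &
        forall (W : set M) X, open W -> W `<=` V -> smooth_field W X ->
          exists a, (forall i, smooth_on W (a i)) /\
            forall q, W q -> X q = combination (None :: map Some (enum 'I_m')) a E q].
Proof.
move=> Up; have [d ad dFp] := atlas_cover (F p).
have [rho [K [srho rho0 cK Kd rhoK]]] := exists_bump_function ad dFp.
pose E' k := fscale rho (fun y => tvec d y (delta_mx 0 k)).
have sE' k : smooth_field setT (E' k) by exact: (smooth_field_bump ad _ srho cK Kd rhoK).
have [Z ZP] := choice (fun k => basic_lift (sE' k)).
pose V' := cdom d `&` rho @^-1` [set t | t != 0].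
have oV' : open V'.
  apply: open_preimage_on; [exact: cdom_open | | exact: open_neq].
  by move=> y _; apply: smooth_at_continuous; exact: (smooth_at_on openT srho).
have oV : open (U `&` F @^-1` V') by exact: (smooth_map_open oU sF).
pose E (i : option 'I_m') := if i is Some k then Z k else xi.
exists (U `&` F @^-1` V'), E, E'; split=> //.
move=> W X oW WV sX; have WU : W `<=` U by move=> q /WV[].
pose a (i : option 'I_m') q := if i is Some k
  then X q (chart_coord d k \o F) * (rho (F q))^-1 else eta q (X q).
have sa i : smooth_on W (a i).
  case: i => [k|]; last by have [_] := oeta; exact.
  apply: smooth_onM => //.
    apply: smooth_field_on => //; apply: smooth_on_sub (smooth_map_coord sF k ad).
    by move=> q /WV[Uq [dFq _]].
  have srhoF : smooth_on W (rho \o F).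
    by apply: smooth_on_sub (smooth_on_comp oU sF openT srho) => q /WU.
  by apply: (smooth_onV oW) => // q /WV[_ []].
exists a; split=> // q Wq; have [Uq [dFq /= rq]] := WV q Wq.
have tX := smooth_field_tangent sX Wq; have txi := smooth_field_tangent sxi (I : setT q).
have [sZ eZ pZ] : [/\ forall k, tangent q (Z k q), forall k, eta q (Z k q) = 0 &
    forall k, push F q (Z k q) = rho (F q) *: tvec d (F q) (delta_mx 0 k)].
  split=> // k; have [sZk eZk _ pZk] := ZP k.
  - exact: smooth_field_tangent sZk Uq.
  - exact: eZk.
  - by rewrite pZk.
have tE i : tangent q (E i q) by case: i.
have taE i : tangent q (a i q *: E i q) by exact: tangentZ.
apply: (horizontal_inj oeta sxi eta_xi push_kernel Uq tX); first exact: tangent_sum.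
  rewrite /combination (oneform_sum oeta) // big_cons big_map big1 ?addr0.
    by rewrite (oneformZ oeta) // eta_xi mulr1.
  by move=> k _; rewrite (oneformZ oeta) // eZ mulr0.
have tc : tangent q (combination (None :: map Some (enum 'I_m')) a E q).
  exact: tangent_sum.
rewrite (push_tvec oU sF Uq tX ad dFq) (push_tvec oU sF Uq tc ad dFq); congr tvec.
apply/rowP => j; rewrite !mxE /combination fct_sumE big_cons big_map big_enum.
have pE v : v (chart_coord d j \o F) = push F q v (chart_coord d j).
  by rewrite pushE //; exact: smooth_at_coord.
have xi0 : xi q (chart_coord d j \o F) = 0.
  by rewrite pE (push_vertical sxi push_kernel).
have ZE k : E (Some k) q (chart_coord d j \o F) = rho (F q) * (j == k)%:R.
  rewrite pE [push F q _]pZ.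
  transitivity (rho (F q) * tvec d (F q) (delta_mx 0 k) (chart_coord d j)) => //.
  by rewrite tvec_coord // mxE.
have aE i : (a i q *: E i q) (chart_coord d j \o F) = a i q * E i q (chart_coord d j \o F).
  by [].
rewrite aE [E None q _]xi0 mulr0 add0r (bigD1 j) // big1 ?addr0.
  by rewrite aE ZE eqxx mulr1 /a mulfVK // [RHS]addr0.
by move=> k kj; rewrite aE ZE eq_sym (negbTE kj) !mulr0.
Qed.

(** A lifted connection is prescribed on [xi] and on basic fields, and these form
    frames locally. *)
Lemma lifted_connection_unique D' D1 D2 :
  lifted_connection xi eta U F D' D1 -> lifted_connection xi eta U F D' D2 ->
  eq_connection U D1 D2.
Proof.
move=> l1 l2 W X Y oW WU sX sY p; rewrite inE => Wp.
have [V [E [E' [[oV VU] Vp EN EP frame]]]] := basic_frame (WU p Wp).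
have oWV := openI oW oV.
have WVW : W `&` V `<=` W by exact: subIsetl.
have WVV : W `&` V `<=` V by exact: subIsetr.
have WVp : (W `&` V) p by [].
have [a [sa XE]] := frame _ _ oWV WVV (smooth_field_sub WVW sX).
have [b [sb YE]] := frame _ _ oWV WVV (smooth_field_sub WVW sY).
have sxiU : smooth_field U xi by exact: smooth_field_sub sxi.
have sE i : smooth_field U (E i) by case: i => [k|]; [have [] := EP k | rewrite EN].
have pU : p \in U by rewrite inE; exact: WU.
apply: (connection_frame_ext (lift_connection l1) (lift_connection l2) oW WU sX sY
  oWV WVW WVp _ sa sb XE YE).
  move=> i; apply: smooth_field_sub (sE i).
  exact: subset_trans WVV VU.
move=> i [l|]; last first.
  by rewrite EN (lift_xi l1 (sE i) pU) (lift_xi l2 (sE i) pU).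
case: i => [k|]; last first.
  by rewrite EN (lift_along_xi l1 (sE (Some l)) pU) (lift_along_xi l2 (sE (Some l)) pU).
have [s1 e1 _ r1] := lift_basic l1 (EP k) (EP l).
have [s2 e2 _ r2] := lift_basic l2 (EP k) (EP l).
rewrite inE in pU.
apply: (horizontal_inj oeta sxi eta_xi push_kernel pU).
- exact: smooth_field_tangent s1 pU.
- exact: smooth_field_tangent s2 pU.
- by rewrite e1 // e2.
- by rewrite r1 // r2.
Qed.

End BasicFrames.

Section TanakaWebsterLifted.
Context {R : realType} {n : nat} {M : manifold R n.*2.+1}.
Context {phi : M -> vec R M -> vec R M} {xi : vecfield R M} {eta : M -> vec R M -> R}.
Context {g : M -> vec R M -> vec R M -> R} {m' : nat} {N : manifold R m'}.
Context {G : N -> vec R N -> vec R N -> R} {U : set M} {F : M -> N}.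
Context {LC : vecfield R M -> vecfield R M -> vecfield R M}.
Context {LC' : vecfield R N -> vecfield R N -> vecfield R N}.
Hypothesis sas : sasakian phi xi eta g.
Hypotheses (lcg : levi_civita g LC) (mG : metric G) (lcG : levi_civita G LC').
Hypotheses (oU : open U) (sF : smooth_map U F).
Hypothesis submersion : forall p, U p -> forall w, tangent (F p) w ->
  exists2 v, tangent p v & push F p v = w.
Hypothesis push_kernel : forall p, U p -> forall v, tangent p v ->
  (push F p v = 0 <-> exists a : R, v = a *: xi p).
Hypothesis isometric : forall p, U p -> forall v w, tangent p v -> tangent p w ->
  eta p v = 0 -> eta p w = 0 -> G (F p) (push F p v) (push F p w) = g p v w.

(** For horizontal [Z1] and [Z2] the vertical part of [LC Z1 Z2] is
    [- d eta (Z1, Z2) xi] by metricity, and the last term of the connection cancels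
    it; the horizontal part is given by [push_levi_civita]. *)
Lemma tanaka_webster_lifted :
  lifted_connection xi eta U F LC' (tanaka_webster phi xi eta LC).
Proof.
have cm : contact_metric phi xi eta g := sas.1.
have oeta : oneform eta := (cm_contact cm).1.
have mg : metric g := cm_metric cm.
have sxi : smooth_field setT xi := reeb_smooth sas setT.
have eta_xi := eta_reeb sas.
split.
- exact: connection_sub (@subsetT _ U) (tanaka_webster_connection sas lcg).
- move=> Z1 Z1' Z2 Z2' [s1 e1 s1' r1] [s2 e2 s2' r2]; split.
  + exact: (tanaka_webster_smooth sas lcg oU s1 s2).
  + move=> p Up; rewrite (tanaka_websterE sas lcg oU s1 s2 Up) e1 // e2 // !scale0r !addr0.
    have t1 := smooth_field_tangent s1 Up; have t2 := smooth_field_tangent s2 Up.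
    have sxiU := reeb_smooth sas U; have txi := reeb_tangent sas p.
    have tLC := smooth_field_tangent (lc_smooth lcg oU s1 s2) Up.
    rewrite (oneformD oeta) // ?(oneformZ oeta) ?eta_xi ?mulr1 //; last exact: tangentZ.
    have := lc_metric lcg oU s1 s2 sxiU Up.
    have -> : Z1 p (fun q => g q (Z2 q) (xi q)) = 0.
      rewrite -[RHS](tangent_cst (0 : R) t1); apply: tangent_near t1 _.
      apply: (open_near_eq oU) Up => q Uq.
      by rewrite (metric_reeb sas) ?e2 //; exact: smooth_field_tangent s2 Uq.
    rewrite (lc_reeb sas lcg oU s1 Up) (metric_reeb sas) // (metricNr mg) //; last first.
      exact: (phi_tangent sas).
    rewrite (metric_phi_skew sas lcg t2 t1); lra.
  + exact: (lc_smooth lcG openT s1' s2').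
  + move=> p Up; rewrite (tanaka_websterE sas lcg oU s1 s2 Up) e1 // e2 // !scale0r !addr0.
    rewrite addrC pushP (push_vertical sxi push_kernel) // scaler0 add0r.
    apply: (push_levi_civita oeta sxi eta_xi oU sF submersion push_kernel mg mG lcg lcG
      (@metric_reeb _ _ _ _ _ _ _ sas) isometric oU _ openT Up s1 s2 s1' s2' e1 e2 r1 r2).
    by move=> q Uq.
- by move=> X sX p; rewrite inE => Up; exact: (tanaka_webster_reeb sas lcg oU sX Up).
- by move=> X sX p; rewrite inE => Up; exact: (tanaka_webster_along_reeb sas lcg oU sX Up).
Qed.

End TanakaWebsterLifted.

Unset Implicit Arguments.

Theorem proposition4p2 (R : realType) (n : nat)
    (M : manifold R n.*2.+1)
    (phi : M -> vec R M -> vec R M) (xi : vecfield R M) (eta : M -> vec R M -> R)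
    (g : M -> vec R M -> vec R M -> R)
    (N : manifold R n.*2)
    (J : N -> vec R N -> vec R N) (omega G : N -> vec R N -> vec R N -> R)
    (I : Type) (U : I -> set M) (f : I -> M -> N) (gamma : I -> I -> N -> N)
    (LC : vecfield R M -> vecfield R M -> vecfield R M)
    (LC' : vecfield R N -> vecfield R N -> vecfield R N) :
  sasakian phi xi eta g ->
  kahler J omega G ->
  transverse_cocycle phi xi eta g J omega G U f gamma ->
  levi_civita g LC ->
  levi_civita G LC' ->
  (forall i, exists D, lifted_connection xi eta (U i) (f i) LC' D) /\
  (forall nabla : I -> vecfield R M -> vecfield R M -> vecfield R M,
     (forall i, lifted_connection xi eta (U i) (f i) LC' (nabla i)) ->
     (forall i j, eq_connection (U i `&` U j) (nabla i) (nabla j)) /\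
     (exists E : vecfield R M -> vecfield R M -> vecfield R M,
        [/\ connection setT E,
            forall i, eq_connection (U i) E (nabla i) &
            eq_connection setT E (tanaka_webster phi xi eta LC)])).
Proof.
move=> sas kah tc lcg lcG.
have oeta : oneform eta := (cm_contact sas.1).1.
have lTW i : lifted_connection xi eta (U i) (f i) LC' (tanaka_webster phi xi eta LC).
  exact: (tanaka_webster_lifted sas lcg (kahler_metric kah) lcG (tc_open tc i)
    (tc_smooth tc i) (@tc_submersion _ _ _ _ _ _ _ _ _ _ _ _ _ _ _ tc i)
    (tc_kernel tc (i := i)) (@tc_metric _ _ _ _ _ _ _ _ _ _ _ _ _ _ _ tc i)).
split; first by move=> i; exists (tanaka_webster phi xi eta LC).
move=> nabla lnabla.
have TWE i : eq_connection (U i) (tanaka_webster phi xi eta LC) (nabla i).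
  apply: (lifted_connection_unique oeta (reeb_smooth sas setT) (eta_reeb sas)
    (tc_open tc i) (tc_smooth tc i) _ _ (lTW i) (lnabla i)).
    exact: (tc_submersion tc (i := i)).
  exact: (tc_kernel tc (i := i)).
split.
  move=> i j W X Y oW WU sX sY p pW.
  have WUi : W `<=` U i by move=> q /WU[].
  have WUj : W `<=` U j by move=> q /WU[].
  by rewrite -(TWE i W X Y oW WUi sX sY p pW) (TWE j W X Y oW WUj sX sY p pW).
exists (tanaka_webster phi xi eta LC); split=> //.
exact: (tanaka_webster_connection sas lcg).
Qed.
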